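(* Let $F$ be holomorphic on $\mathbb{D}=\{z\in\mathbb{C}:|z|<1\}$ with $F(0)=0$ and $F'(0)=1$. Then the following statements are equivalent: (1) $F$ is starlike with respect to $0$; (2) $\mathrm{Re}\big(F(z)^{-1}zF'(z)\big)>0$ on $\mathbb{D}$; (3) for any $\theta\in[0,2\pi)$, the function $M(r)=|F(re^{i\theta})|$ is strictly increasing on $[0,1)$.
   Context: A holomorphic $F$ on $\mathbb{D}$ is starlike with respect to $0$ if $F$ is injective on $\mathbb{D}$ and $tF(\mathbb{D})\subset F(\mathbb{D})$ for all $t\in[0,1]$. In (2), the expression $F(z)^{-1}zF'(z)$ at $z=0$ is understood as its limit value $1$, and the condition presupposes $F(z)\neq0$ for $z\ne0$. *)

(* Defs.v *)
From Stdlib Require Import Reals.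
From Coquelicot Require Import Coquelicot.
Open Scope R_scope.
Open Scope C_scope.

Definition unit_disk (z : C) : Prop := (Cmod z < 1)%R.

Definition holomorphic_on (D : C -> Prop) (F : C -> C) : Prop :=
  forall z : C, D z -> ex_derive (K := C_AbsRing) (V := C_NormedModule) F z.

Definition injective_on (D : C -> Prop) (F : C -> C) : Prop :=
  forall z1 z2 : C, D z1 -> D z2 -> F z1 = F z2 -> z1 = z2.

Definition image (F : C -> C) (D : C -> Prop) (w : C) : Prop :=
  exists z : C, D z /\ F z = w.

Definition starlike_wrt_0 (F : C -> C) : Prop :=
  injective_on unit_disk F /\
  forall t : R, (0 <= t <= 1)%R ->
  forall w : C, image F unit_disk w -> image F unit_disk (RtoC t * w).

(* At z = 0 the quotient is 0/0; it takes there its limit value, which is 1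
   when F is holomorphic at 0 with F 0 = 0 and a nonzero derivative at 0. *)
Definition starlike_quotient (F : C -> C) (z : C) : C :=
  if Ceq_dec z 0 then 1 else / F z * z * C_derive F z.

(* The nonvanishing of F is explicit because Cinv is total, with / 0 = 0. *)
Definition starlike_quotient_Re_pos (F : C -> C) : Prop :=
  (forall z : C, unit_disk z -> z <> 0 -> F z <> 0) /\
  (forall z : C, unit_disk z -> (0 < Re (starlike_quotient F z))%R).

Definition cis (theta : R) : C := (cos theta, sin theta).

Definition strictly_increasing_on_01 (M : R -> R) : Prop :=
  forall r s : R, (0 <= r)%R -> (r < s)%R -> (s < 1)%R -> (M r < M s)%R.

Definition radially_increasing_modulus (F : C -> C) : Prop :=
  forall theta : R, (0 <= theta < 2 * PI)%R ->
  strictly_increasing_on_01 (fun r : R => Cmod (F (RtoC r * cis theta))).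

(* Main.v *)
(* With F(z) = z F1(z), the quotient z F'(z) / F(z) is p = F' / F1, which is
   holomorphic as soon as F does not vanish off 0, and p(0) = 1. If Re p >= 0, the
   Schwarz lemma for (p - 1) / (p + 1) gives Re p > 0.
   (2) <-> (3): on the ray of z = r e^(i theta), r d/dr |F|^2 = 2 |F|^2 Re p.
   (1) -> (2): the maps G_t = F^-1 (t F), t < 1, send the disk into itself and fix 0,
   so |G_t(z)| <= |z|; letting t tend to 1 in G_t(z) = z - (1 - t) (F(z) / F'(z) + o(1))
   gives Re (conj z F(z) / F'(z)) >= 0.
   (2) -> (1): conversely Re p > 0 makes the local solution w of F(w) = t F(z), t < 1
   close to 1, satisfy |w| < |z|; so solutions can be continued, inside a compact disk,
   down to t = 0. Two distinct points with the same value would yield two distinct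
   zeros of F, since the branches cannot merge where F' <> 0.
   Differentiability is only assumed pointwise, so regularity comes from Goursat's
   bisection argument, applied to the closed form (Im f / r) dr + Re f dtheta in polar
   coordinates; it yields the mean value property, Cauchy's formula, the maximum
   principle and the removability of continuous singularities. *)
Require Import Defs.
From Stdlib Require Import Reals Lra Lia Classical ClassicalEpsilon.
From Coquelicot Require Import Coquelicot.
Open Scope R_scope.

(** * Complex differentiability *)

(** Pointwise differentiability gives no continuity of the derivative; this rules out Green's
    theorem and forces the bisection. All complex integrals run over circles: an annulus is a
    rectangle in polar coordinates, so rectangles are the only contours. Cauchy's formula at [z] is
    the mean value property of a slope at [z], a function known at that stage to be merely
    continuous at [z]; hence the mean value property tolerates one exceptional circle besides the
    centre. Slopes replace power series: removability keeps them holomorphic, so [z - a] can be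
    divided out repeatedly, which gives isolated zeros and then open mapping. Starlikeness leads to
    the quotient [F / F'], so an injective function must first be shown to have no critical point.
    Limits of comparisons of moduli are only non-strict, hence the strictness argument shared by two
    implications. Existence and uniqueness of preimages use the same downward continuation in [t],
    with compactness at limits and a first-order comparison at steps, in place of the argument
    principle. *)

Definition ccont (f : C -> C) (a : C) : Prop :=
  forall eps, 0 < eps -> exists delta, 0 < delta /\
    forall z, Cmod (z - a) < delta -> Cmod (f z - f a) < eps.

Definition slope (f : C -> C) (a l z : C) : C :=
  if Ceq_dec z a then l else ((f z - f a) / (z - a))%C.

(* Carathéodory's form of differentiability: products, inverses and
   compositions become identities between slopes. *)
Definition cderiv (f : C -> C) (a l : C) : Prop := ccont (slope f a l) a.

Definition cdiff (f : C -> C) (a : C) : Prop := exists l, cderiv f a l.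

Lemma Cmod_sub_sym (x y : C) : Cmod (x - y) = Cmod (y - x).
Proof. rewrite <- Cmod_opp. f_equal. ring. Qed.

Lemma Cmod_sub_self (x : C) : Cmod (x - x) = 0.
Proof. replace (x - x)%C with (RtoC 0) by ring. apply Cmod_0. Qed.

Lemma Cmod_triangle_sub (x y z : C) : Cmod (x - z) <= Cmod (x - y) + Cmod (y - z).
Proof.
  replace (x - z)%C with ((x - y) + (y - z))%C by ring. apply Cmod_triangle.
Qed.

Lemma Cmod_triangle_inv (x y : C) : Cmod x - Cmod y <= Cmod (x - y).
Proof.
  pose proof (Cmod_triangle (x - y) y) as H.
  replace (x - y + y)%C with x in H by ring. lra.
Qed.

Lemma Csub_neq_0 (x y : C) : x <> y -> (x - y)%C <> 0%C.
Proof.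
  intros H H0. apply H. replace x with ((x - y) + y)%C by ring. rewrite H0. ring.
Qed.

Lemma Cmod_sub_gt_0 (x y : C) : x <> y -> 0 < Cmod (x - y).
Proof. intros H. apply Cmod_gt_0, Csub_neq_0, H. Qed.

Lemma Cmod_small_eq_0 (x : C) : (forall eps, 0 < eps -> Cmod x < eps) -> x = 0%C.
Proof.
  intros H. apply Cmod_eq_0. destruct (Rle_lt_or_eq_dec 0 (Cmod x) (Cmod_ge_0 x)) as [Hp | <-].
  - specialize (H _ Hp). lra.
  - reflexivity.
Qed.

Lemma ccont_ext_loc (f g : C -> C) (a : C) (r : R) :
  0 < r -> (forall z, Cmod (z - a) < r -> f z = g z) -> ccont f a -> ccont g a.
Proof.
  intros Hr Hfg Hf eps Heps. destruct (Hf eps Heps) as [d [Hd H]].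
  exists (Rmin d r). split; [apply Rmin_pos; assumption |].
  intros z Hz.
  pose proof (Rmin_l d r). pose proof (Rmin_r d r).
  rewrite <- (Hfg z) by lra. rewrite <- (Hfg a) by (rewrite Cmod_sub_self; lra).
  apply H. lra.
Qed.

Lemma ccont_const (c a : C) : ccont (fun _ => c) a.
Proof.
  intros eps Heps. exists 1. split; [lra |]. intros z _. rewrite Cmod_sub_self. exact Heps.
Qed.

Lemma ccont_id (a : C) : ccont (fun z => z) a.
Proof. intros eps Heps. exists eps. auto. Qed.

Lemma ccont_plus (f g : C -> C) (a : C) :
  ccont f a -> ccont g a -> ccont (fun z => (f z + g z)%C) a.
Proof.
  intros Hf Hg eps Heps.
  destruct (Hf (eps / 2)) as [d1 [Hd1 H1]]; [lra |].
  destruct (Hg (eps / 2)) as [d2 [Hd2 H2]]; [lra |].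
  exists (Rmin d1 d2). split; [apply Rmin_pos; assumption |].
  intros z Hz. pose proof (Rmin_l d1 d2). pose proof (Rmin_r d1 d2).
  specialize (H1 z ltac:(lra)). specialize (H2 z ltac:(lra)).
  replace (f z + g z - (f a + g a))%C with ((f z - f a) + (g z - g a))%C by ring.
  pose proof (Cmod_triangle (f z - f a) (g z - g a)). lra.
Qed.

Lemma ccont_mult (f g : C -> C) (a : C) :
  ccont f a -> ccont g a -> ccont (fun z => (f z * g z)%C) a.
Proof.
  intros Hf Hg eps Heps.
  pose proof (Cmod_ge_0 (f a)) as Ha. pose proof (Cmod_ge_0 (g a)) as Hb.
  (* [e1] is fixed first because it bounds [Cmod (f z)] by [Cmod (f a) + e1], a quantity that is
     positive even when [f a = 0]; this is the denominator in [e2]. *)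
  set (e1 := eps / (2 * (Cmod (g a) + 1))).
  set (e2 := Rmin 1 (eps / (2 * (Cmod (f a) + e1)))).
  assert (He1 : 0 < e1) by (apply Rdiv_lt_0_compat; lra).
  assert (He2 : 0 < e2) by (apply Rmin_pos; [lra | apply Rdiv_lt_0_compat; lra]).
  destruct (Hf e1 He1) as [d1 [Hd1 H1]].
  destruct (Hg e2 He2) as [d2 [Hd2 H2]].
  exists (Rmin d1 d2). split; [apply Rmin_pos; assumption |].
  intros z Hz. pose proof (Rmin_l d1 d2). pose proof (Rmin_r d1 d2).
  specialize (H1 z ltac:(lra)). specialize (H2 z ltac:(lra)).
  replace (f z * g z - f a * g a)%C
    with (f z * (g z - g a) + (f z - f a) * g a)%C by ring.
  eapply Rle_lt_trans; [apply Cmod_triangle |]. rewrite !Cmod_mult.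
  assert (Hfz : Cmod (f z) <= Cmod (f a) + e1).
  { pose proof (Cmod_triangle_inv (f z) (f a)). lra. }
  assert (A1 : Cmod (f z) * Cmod (g z - g a) <= eps / 2).
  { apply Rle_trans with ((Cmod (f a) + e1) * (eps / (2 * (Cmod (f a) + e1)))).
    - apply Rmult_le_compat; try apply Cmod_ge_0; [exact Hfz |].
      unfold e2 in H2. pose proof (Rmin_r 1 (eps / (2 * (Cmod (f a) + e1)))). lra.
    - right. field. lra. }
  assert (A2 : Cmod (f z - f a) * Cmod (g a) < eps / 2).
  { apply Rle_lt_trans with (e1 * Cmod (g a)).
    - apply Rmult_le_compat_r; lra.
    - apply Rlt_le_trans with (e1 * (Cmod (g a) + 1)).
      + apply Rmult_lt_compat_l; lra.
      + right. unfold e1. field. lra. }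
  lra.
Qed.

Lemma ccont_opp (f : C -> C) (a : C) : ccont f a -> ccont (fun z => (- f z)%C) a.
Proof.
  intros Hf. apply (ccont_ext_loc (fun z => ((-1) * f z)%C) _ a 1); [lra | |].
  - intros z _. ring.
  - apply ccont_mult; [apply ccont_const | exact Hf].
Qed.

Lemma ccont_minus (f g : C -> C) (a : C) :
  ccont f a -> ccont g a -> ccont (fun z => (f z - g z)%C) a.
Proof. intros Hf Hg. apply ccont_plus; [exact Hf | apply ccont_opp, Hg]. Qed.

Lemma ccont_comp (f g : C -> C) (a : C) :
  ccont g a -> ccont f (g a) -> ccont (fun z => f (g z)) a.
Proof.
  intros Hg Hf eps Heps. destruct (Hf eps Heps) as [d [Hd H]].
  destruct (Hg d Hd) as [d' [Hd' H']]. exists d'. auto.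
Qed.

Lemma ccont_neq_0 (f : C -> C) (a : C) : ccont f a -> f a <> 0%C ->
  exists delta, 0 < delta /\ forall z, Cmod (z - a) < delta -> Cmod (f a) / 2 < Cmod (f z).
Proof.
  intros Hf Ha. apply Cmod_gt_0 in Ha.
  destruct (Hf (Cmod (f a) / 2)) as [d [Hd H]]; [lra |].
  exists d. split; [exact Hd |]. intros z Hz. specialize (H z Hz).
  rewrite Cmod_sub_sym in H. pose proof (Cmod_triangle_inv (f a) (f z)). lra.
Qed.

Lemma ccont_inv (f : C -> C) (a : C) :
  ccont f a -> f a <> 0%C -> ccont (fun z => (/ f z)%C) a.
Proof.
  intros Hf Ha eps Heps.
  destruct (ccont_neq_0 f a Hf Ha) as [d1 [Hd1 H1]].
  assert (Hp : 0 < Cmod (f a)) by (apply Cmod_gt_0; exact Ha).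
  destruct (Hf (eps * (Cmod (f a) * (Cmod (f a) / 2)))) as [d2 [Hd2 H2]].
  { apply Rmult_lt_0_compat; [lra |]. apply Rmult_lt_0_compat; lra. }
  exists (Rmin d1 d2). split; [apply Rmin_pos; assumption |].
  intros z Hz. pose proof (Rmin_l d1 d2). pose proof (Rmin_r d1 d2).
  specialize (H1 z ltac:(lra)). specialize (H2 z ltac:(lra)).
  assert (Hz0 : f z <> 0%C) by (apply Cmod_gt_0; lra).
  replace (/ f z - / f a)%C with (- ((f z - f a) / (f a * f z)))%C
    by (field; split; assumption).
  assert (Hm : (f a * f z)%C <> 0%C) by (apply Cmult_neq_0; assumption).
  rewrite Cmod_opp, Cmod_div, Cmod_mult by exact Hm.
  apply Rmult_lt_reg_r with (Cmod (f a) * Cmod (f z)).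
  - apply Rmult_lt_0_compat; lra.
  - unfold Rdiv at 1. rewrite Rmult_assoc, Rinv_l, Rmult_1_r.
    + eapply Rlt_trans; [exact H2 |]. apply Rmult_lt_compat_l; [exact Heps |].
      apply Rmult_lt_compat_l; lra.
    + apply Rgt_not_eq, Rmult_lt_0_compat; lra.
Qed.

Lemma slope_at (f : C -> C) (a l : C) : slope f a l a = l.
Proof. unfold slope. destruct (Ceq_dec a a); [reflexivity | congruence]. Qed.

Lemma slope_neq (f : C -> C) (a l z : C) :
  z <> a -> slope f a l z = ((f z - f a) / (z - a))%C.
Proof. intros H. unfold slope. destruct (Ceq_dec z a); [congruence | reflexivity]. Qed.

Lemma slope_eq (f : C -> C) (a l z : C) : f z = (f a + (z - a) * slope f a l z)%C.
Proof.
  unfold slope. destruct (Ceq_dec z a) as [-> | H].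
  - ring.
  - field. apply Csub_neq_0, H.
Qed.

(** Off [a] any such [q] is forced to be the slope, so a rule of differentiation only has to exhibit
    a factorization with a continuous [q]. *)
Lemma cderiv_intro (f q : C -> C) (a : C) (r : R) : 0 < r ->
  (forall z, Cmod (z - a) < r -> f z = (f a + (z - a) * q z)%C) -> ccont q a ->
  cderiv f a (q a).
Proof.
  intros Hr H Hq. apply (ccont_ext_loc q _ a r Hr); [| exact Hq].
  intros z Hz. unfold slope. destruct (Ceq_dec z a) as [-> | Hza]; [reflexivity |].
  rewrite (H z Hz). field. apply Csub_neq_0, Hza.
Qed.

Lemma cderiv_ext_loc (f g : C -> C) (a l : C) (r : R) : 0 < r ->
  (forall z, Cmod (z - a) < r -> f z = g z) -> cderiv f a l -> cderiv g a l.
Proof.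
  intros Hr H Hf. rewrite <- (slope_at f a l).
  apply (cderiv_intro _ _ _ r Hr); [| exact Hf].
  intros z Hz. rewrite <- !H; [apply slope_eq | | exact Hz].
  rewrite Cmod_sub_self. exact Hr.
Qed.

Lemma cdiff_ext_loc (f g : C -> C) (a : C) (r : R) : 0 < r ->
  (forall z, Cmod (z - a) < r -> f z = g z) -> cdiff f a -> cdiff g a.
Proof. intros Hr H [l Hl]. exists l. apply (cderiv_ext_loc f g a l r); assumption. Qed.

Lemma cderiv_ccont (f : C -> C) (a l : C) : cderiv f a l -> ccont f a.
Proof.
  intros H. apply (ccont_ext_loc (fun z => (f a + (z - a) * slope f a l z)%C) _ a 1); [lra | |].
  - intros z _. symmetry. apply slope_eq.
  - apply ccont_plus; [apply ccont_const |]. apply ccont_mult; [| exact H].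
    apply ccont_minus; [apply ccont_id | apply ccont_const].
Qed.

Lemma cdiff_ccont (f : C -> C) (a : C) : cdiff f a -> ccont f a.
Proof. intros [l H]. exact (cderiv_ccont f a l H). Qed.

(** The points [a + d / 2] approach [a], so continuity leaves no freedom for the value at [a].
    Applied to a difference of slopes, this makes derivatives unique. *)
Lemma ccont_0_unique (f : C -> C) (a : C) :
  ccont f a -> (forall z, z <> a -> f z = 0%C) -> f a = 0%C.
Proof.
  intros Hf H. apply Cmod_small_eq_0. intros eps Heps.
  destruct (Hf eps Heps) as [d [Hd Hz]].
  specialize (Hz (a + RtoC (d / 2))%C).
  assert (E : (a + RtoC (d / 2) - a)%C = RtoC (d / 2)) by ring.
  rewrite E, Cmod_R, Rabs_pos_eq in Hz by lra.
  rewrite (H (a + RtoC (d / 2))%C) in Hz.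
  - replace (0 - f a)%C with (- f a)%C in Hz by ring. rewrite Cmod_opp in Hz. apply Hz. lra.
  - intros Ha. rewrite Ha in E. replace (a - a)%C with (RtoC 0) in E by ring.
    apply RtoC_inj in E. lra.
Qed.

Lemma cderiv_unique (f : C -> C) (a l l' : C) : cderiv f a l -> cderiv f a l' -> l = l'.
Proof.
  intros H H'.
  assert (E : (slope f a l a - slope f a l' a)%C = 0%C).
  { apply (ccont_0_unique (fun z => (slope f a l z - slope f a l' z)%C)).
    - apply ccont_minus; assumption.
    - intros z Hz. rewrite !slope_neq by exact Hz. ring. }
  rewrite !slope_at in E. replace l with ((l - l') + l')%C by ring. rewrite E. ring.
Qed.

Lemma cderiv_const (c a : C) : cderiv (fun _ => c) a 0.
Proof.
  apply (cderiv_intro _ (fun _ => 0%C) a 1); [lra | | apply ccont_const].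
  intros; ring.
Qed.

Lemma cderiv_id (a : C) : cderiv (fun z => z) a 1.
Proof.
  apply (cderiv_intro _ (fun _ => 1%C) a 1); [lra | | apply ccont_const].
  intros; ring.
Qed.

Lemma cderiv_plus (f g : C -> C) (a l m : C) : cderiv f a l -> cderiv g a m ->
  cderiv (fun z => (f z + g z)%C) a (l + m).
Proof.
  intros Hf Hg.
  replace (l + m)%C with (slope f a l a + slope g a m a)%C by (now rewrite !slope_at).
  apply (cderiv_intro _ (fun z => (slope f a l z + slope g a m z)%C) a 1); [lra | |].
  - intros z _. rewrite (slope_eq f a l z), (slope_eq g a m z) at 1. ring.
  - apply ccont_plus; assumption.
Qed.

Lemma cderiv_mult (f g : C -> C) (a l m : C) : cderiv f a l -> cderiv g a m ->
  cderiv (fun z => (f z * g z)%C) a (l * g a + f a * m).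
Proof.
  intros Hf Hg.
  replace (l * g a + f a * m)%C with (slope f a l a * g a + f a * slope g a m a)%C
    by (now rewrite !slope_at).
  apply (cderiv_intro _ (fun z => (slope f a l z * g z + f a * slope g a m z)%C) a 1); [lra | |].
  - intros z _. cbv beta. rewrite (slope_eq f a l z) at 1.
    rewrite (slope_eq g a m z). ring.
  - apply ccont_plus; apply ccont_mult; try assumption; [| apply ccont_const].
    exact (cderiv_ccont g a m Hg).
Qed.

Lemma cderiv_inv (f : C -> C) (a l : C) : cderiv f a l -> f a <> 0%C ->
  cderiv (fun z => (/ f z)%C) a (- l / (f a * f a)).
Proof.
  intros Hf Ha. pose proof (cderiv_ccont f a l Hf) as Hc.
  destruct (ccont_neq_0 f a Hc Ha) as [d [Hd Hn]].
  apply Cmod_gt_0 in Ha as Hp.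
  replace (- l / (f a * f a))%C with (- slope f a l a * / (f a * f a))%C by (now rewrite slope_at).
  apply (cderiv_intro _ (fun z => (- slope f a l z * / (f a * f z))%C) a d Hd).
  - intros z Hz. specialize (Hn z Hz).
    assert (Hz0 : f z <> 0%C) by (apply Cmod_gt_0; lra).
    assert (E : ((z - a) * slope f a l z)%C = (f z - f a)%C)
      by (rewrite (slope_eq f a l z) at 1; ring).
    replace ((z - a) * (- slope f a l z * / (f a * f z)))%C
      with (- ((z - a) * slope f a l z) * / (f a * f z))%C by ring.
    rewrite E. field. split; assumption.
  - apply ccont_mult; [apply ccont_opp; exact Hf |].
    apply ccont_inv; [| apply Cmult_neq_0; assumption].
    apply ccont_mult; [apply ccont_const | exact Hc].
Qed.

Lemma cderiv_comp (f g : C -> C) (a l m : C) : cderiv f (g a) l -> cderiv g a m ->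
  cderiv (fun z => f (g z)) a (l * m).
Proof.
  intros Hf Hg.
  replace (l * m)%C with (slope f (g a) l (g a) * slope g a m a)%C by (now rewrite !slope_at).
  apply (cderiv_intro _ (fun z => (slope f (g a) l (g z) * slope g a m z)%C) a 1); [lra | |].
  - intros z _. rewrite (slope_eq f (g a) l (g z)) at 1. f_equal.
    replace (g z - g a)%C with ((z - a) * slope g a m z)%C; [ring |].
    rewrite (slope_eq g a m z) at 1. ring.
  - apply ccont_mult; [| exact Hg]. apply (ccont_comp (slope f (g a) l) g); [| exact Hf].
    exact (cderiv_ccont g a m Hg).
Qed.

Lemma cdiff_const (c a : C) : cdiff (fun _ => c) a.
Proof. eexists. apply cderiv_const. Qed.

Lemma cdiff_id (a : C) : cdiff (fun z => z) a.
Proof. eexists. apply cderiv_id. Qed.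

Lemma cdiff_plus (f g : C -> C) (a : C) :
  cdiff f a -> cdiff g a -> cdiff (fun z => (f z + g z)%C) a.
Proof. intros [l Hl] [m Hm]. eexists. exact (cderiv_plus f g a l m Hl Hm). Qed.

Lemma cdiff_mult (f g : C -> C) (a : C) :
  cdiff f a -> cdiff g a -> cdiff (fun z => (f z * g z)%C) a.
Proof. intros [l Hl] [m Hm]. eexists. exact (cderiv_mult f g a l m Hl Hm). Qed.

Lemma cdiff_minus (f g : C -> C) (a : C) :
  cdiff f a -> cdiff g a -> cdiff (fun z => (f z - g z)%C) a.
Proof.
  intros Hf Hg. apply (cdiff_ext_loc (fun z => (f z + (-1) * g z)%C) _ a 1); [lra | |].
  - intros; ring.
  - apply cdiff_plus; [exact Hf |]. apply cdiff_mult; [apply cdiff_const | exact Hg].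
Qed.

Lemma cdiff_inv (f : C -> C) (a : C) :
  cdiff f a -> f a <> 0%C -> cdiff (fun z => (/ f z)%C) a.
Proof. intros [l Hl] Ha. eexists. exact (cderiv_inv f a l Hl Ha). Qed.

Lemma cdiff_comp (f g : C -> C) (a : C) :
  cdiff f (g a) -> cdiff g a -> cdiff (fun z => f (g z)) a.
Proof. intros [l Hl] [m Hm]. eexists. exact (cderiv_comp f g a l m Hl Hm). Qed.

Lemma cdiff_pow (f : C -> C) (a : C) (n : nat) : cdiff f a -> cdiff (fun z => (f z ^ n)%C) a.
Proof.
  intros Hf. induction n as [| n IH]; simpl.
  - apply cdiff_const.
  - apply cdiff_mult; assumption.
Qed.

Lemma ccont_pow (f : C -> C) (a : C) (n : nat) : ccont f a -> ccont (fun z => (f z ^ n)%C) a.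
Proof.
  intros Hf. induction n as [| n IH]; simpl.
  - apply ccont_const.
  - apply ccont_mult; assumption.
Qed.

Lemma is_derive_cderiv (f : C -> C) (a l : C) :
  is_derive (K := C_AbsRing) (V := C_NormedModule) f a l -> cderiv f a l.
Proof.
  intros [_ H] eps Heps.
  specialize (H a (fun P HP => HP)).
  (* The domination in [is_derive] is non-strict; halving [eps] restores the strict inequality of
     [ccont]. *)
  assert (He : 0 < eps / 2) by lra.
  destruct (H (mkposreal _ He)) as [d Hd]. simpl in Hd.
  exists d. split; [apply cond_pos |].
  intros z Hz. rewrite slope_at.
  destruct (Ceq_dec z a) as [-> | Hza].
  - rewrite slope_at, Cmod_sub_self. exact Heps.
  - specialize (Hd z Hz). rewrite slope_neq by exact Hza.
    change (Cmod ((f z - f a) - (z - a) * l) <= eps / 2 * Cmod (z - a)) in Hd.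
    pose proof (Cmod_sub_gt_0 z a Hza) as Hp.
    replace ((f z - f a) / (z - a) - l)%C with (((f z - f a) - (z - a) * l) / (z - a))%C
      by (field; apply Csub_neq_0, Hza).
    rewrite Cmod_div by (apply Csub_neq_0, Hza).
    apply Rle_lt_trans with (eps / 2); [| lra].
    apply Rmult_le_reg_r with (Cmod (z - a)); [exact Hp |].
    unfold Rdiv at 1. rewrite Rmult_assoc, Rinv_l, Rmult_1_r by lra. exact Hd.
Qed.

Lemma ex_derive_cderiv (f : C -> C) (a : C) :
  ex_derive (K := C_AbsRing) (V := C_NormedModule) f a -> cderiv f a (C_derive f a).
Proof. intros H. apply is_derive_cderiv, (C_derive_correct f a 0 H). Qed.

(** * Goursat's theorem for closed forms *)

Lemma continuity_2d_pt_fst (f : R -> R -> R) (x y : R) :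
  continuity_2d_pt f x y -> continuous (fun t => f t y) x.
Proof.
  intros H. apply continuity_pt_filterlim. intros eps Heps.
  destruct (H (mkposreal eps Heps)) as [d Hd].
  exists d. split; [apply cond_pos |]. intros t [_ Ht].
  apply Hd; [exact Ht |]. rewrite Rminus_diag, Rabs_R0. apply cond_pos.
Qed.

Lemma continuity_2d_pt_snd (f : R -> R -> R) (x y : R) :
  continuity_2d_pt f x y -> continuous (fun t => f x t) y.
Proof.
  intros H. apply continuity_pt_filterlim. intros eps Heps.
  destruct (H (mkposreal eps Heps)) as [d Hd].
  exists d. split; [apply cond_pos |]. intros t [_ Ht].
  apply Hd; [| exact Ht]. rewrite Rminus_diag, Rabs_R0. apply cond_pos.
Qed.

Lemma ex_RInt_sub (f g : R -> R) (a b : R) :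
  ex_RInt f a b -> ex_RInt g a b -> ex_RInt (fun x => f x - g x) a b.
Proof. exact (ex_RInt_minus (V := R_NormedModule) f g a b). Qed.

Lemma RInt_sub (f g : R -> R) (a b : R) : ex_RInt f a b -> ex_RInt g a b ->
  RInt (fun x => f x - g x) a b = RInt f a b - RInt g a b.
Proof. exact (RInt_minus (V := R_CompleteNormedModule) f g a b). Qed.

Lemma RInt_add (f g : R -> R) (a b : R) : ex_RInt f a b -> ex_RInt g a b ->
  RInt (fun x => f x + g x) a b = RInt f a b + RInt g a b.
Proof. exact (RInt_plus (V := R_CompleteNormedModule) f g a b). Qed.

Lemma RInt_constant (c a b : R) : RInt (fun _ => c) a b = (b - a) * c.
Proof. exact (RInt_const (V := R_CompleteNormedModule) a b c). Qed.

(** The counterclockwise circulation of [P dx + Q dy] around a rectangle, with opposite sides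
    grouped so that their contributions can be compared under one integral sign. *)
Definition loop_integral (P Q : R -> R -> R) (a b c d : R) : R :=
  RInt (fun x => P x c - P x d) a b + RInt (fun y => Q b y - Q a y) c d.

Section Goursat.

Variables (P Q : R -> R -> R) (xmin xmax ymin ymax : R).

(** Closedness is the shared [k]: the [y]-derivative of [P] equals the [x]-derivative of [Q].
    Continuity of the partial derivatives is not assumed. *)
Hypothesis closed_form : forall x y, xmin <= x <= xmax -> ymin <= y <= ymax ->
  exists p k q, differentiable_pt_lim P x y p k /\ differentiable_pt_lim Q x y k q.

Lemma closed_form_continuous (x y : R) : xmin <= x <= xmax -> ymin <= y <= ymax ->
  continuity_2d_pt P x y /\ continuity_2d_pt Q x y.
Proof.
  intros Hx Hy. destruct (closed_form x y Hx Hy) as [p [k [q [HP HQ]]]].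
  split; apply differentiable_continuity_pt; eexists; eexists; eassumption.
Qed.

Lemma ex_RInt_closed_form_fst (a b y : R) : xmin <= a -> a <= b -> b <= xmax -> ymin <= y <= ymax ->
  ex_RInt (fun x => P x y) a b.
Proof.
  intros Ha Hab Hb Hy. apply (ex_RInt_continuous (V := R_CompleteNormedModule)).
  rewrite Rmin_left, Rmax_right by exact Hab. intros x Hx.
  apply continuity_2d_pt_fst, closed_form_continuous; lra.
Qed.

Lemma ex_RInt_closed_form_snd (c d x : R) : ymin <= c -> c <= d -> d <= ymax -> xmin <= x <= xmax ->
  ex_RInt (fun y => Q x y) c d.
Proof.
  intros Hc Hcd Hd Hx. apply (ex_RInt_continuous (V := R_CompleteNormedModule)).
  rewrite Rmin_left, Rmax_right by exact Hcd. intros y Hy.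
  apply continuity_2d_pt_snd, closed_form_continuous; lra.
Qed.

Lemma loop_integral_split_fst (a m b c d : R) :
  xmin <= a -> a <= m -> m <= b -> b <= xmax -> ymin <= c -> c <= d -> d <= ymax ->
  loop_integral P Q a b c d = loop_integral P Q a m c d + loop_integral P Q m b c d.
Proof.
  intros. unfold loop_integral.
  rewrite <- (RInt_Chasles (fun x => P x c - P x d) a m b).
  - rewrite (RInt_ext (fun y => Q b y - Q a y)
      (fun y => (Q m y - Q a y) + (Q b y - Q m y))).
    + rewrite (RInt_add
        (fun y => Q m y - Q a y) (fun y => Q b y - Q m y)).
      * unfold plus; simpl; ring.
      * apply ex_RInt_sub; apply ex_RInt_closed_form_snd; lra.
      * apply ex_RInt_sub; apply ex_RInt_closed_form_snd; lra.
    + intros y _. unfold plus; simpl; ring.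
  - apply ex_RInt_sub; apply ex_RInt_closed_form_fst; lra.
  - apply ex_RInt_sub; apply ex_RInt_closed_form_fst; lra.
Qed.

Lemma loop_integral_split_snd (a b c m d : R) :
  xmin <= a -> a <= b -> b <= xmax -> ymin <= c -> c <= m -> m <= d -> d <= ymax ->
  loop_integral P Q a b c d = loop_integral P Q a b c m + loop_integral P Q a b m d.
Proof.
  intros. unfold loop_integral.
  rewrite <- (RInt_Chasles (fun y => Q b y - Q a y) c m d).
  - rewrite (RInt_ext (fun x => P x c - P x d)
      (fun x => (P x c - P x m) + (P x m - P x d))).
    + rewrite (RInt_add
        (fun x => P x c - P x m) (fun x => P x m - P x d)).
      * unfold plus; simpl; ring.
      * apply ex_RInt_sub; apply ex_RInt_closed_form_fst; lra.
      * apply ex_RInt_sub; apply ex_RInt_closed_form_fst; lra.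
    + intros x _. unfold plus; simpl; ring.
  - apply ex_RInt_sub; apply ex_RInt_closed_form_snd; lra.
  - apply ex_RInt_sub; apply ex_RInt_closed_form_snd; lra.
Qed.

(* Only the common cross derivative [k] of the linear parts contributes to the
   two integrals, and its contributions [k w h] cancel. *)
Lemma loop_integral_local (u v eps : R) : xmin <= u <= xmax -> ymin <= v <= ymax -> 0 < eps ->
  exists delta, 0 < delta /\ forall x y w h,
    xmin <= x -> x + w <= xmax -> ymin <= y -> y + h <= ymax -> 0 <= w < delta -> 0 <= h < delta ->
    x <= u <= x + w -> y <= v <= y + h ->
    Rabs (loop_integral P Q x (x + w) y (y + h)) <= eps * (w + h) ^ 2.
Proof.
  intros Hu Hv Heps. destruct (closed_form u v Hu Hv) as [p [k [q [HP HQ]]]].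
  assert (He2 : 0 < eps / 2) by lra.
  destruct (HP (mkposreal _ He2)) as [d1 H1]. destruct (HQ (mkposreal _ He2)) as [d2 H2].
  simpl in H1, H2.
  exists (Rmin d1 d2). split; [apply Rmin_pos; apply cond_pos |].
  intros x y w h Hx Hxw Hy Hyh Hw Hh Hux Hvy.
  pose proof (Rmin_l d1 d2). pose proof (Rmin_r d1 d2).
  assert (Hmax : forall s t, x <= s <= x + w -> y <= t <= y + h ->
    Rmax (Rabs (s - u)) (Rabs (t - v)) <= w + h).
  { intros s t Hs Ht. apply Rmax_lub; apply Rabs_le; lra. }
  assert (E1 : forall s t, x <= s <= x + w -> y <= t <= y + h ->
    Rabs (P s t - P u v - (p * (s - u) + k * (t - v))) <= eps / 2 * (w + h)).
  { intros s t Hs Ht. eapply Rle_trans.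
    - apply H1; apply Rabs_def1; lra.
    - apply Rmult_le_compat_l; [lra | auto]. }
  assert (E2 : forall s t, x <= s <= x + w -> y <= t <= y + h ->
    Rabs (Q s t - Q u v - (k * (s - u) + q * (t - v))) <= eps / 2 * (w + h)).
  { intros s t Hs Ht. eapply Rle_trans.
    - apply H2; apply Rabs_def1; lra.
    - apply Rmult_le_compat_l; [lra | auto]. }
  assert (X1 : ex_RInt (fun s => P s y - P s (y + h)) x (x + w)).
  { apply ex_RInt_sub; apply ex_RInt_closed_form_fst; lra. }
  assert (X2 : ex_RInt (fun t => Q (x + w) t - Q x t) y (y + h)).
  { apply ex_RInt_sub; apply ex_RInt_closed_form_snd; lra. }
  (* On two opposite sides the errors add up to [eps * (w + h)]; the side lengths [w] and [h]
     contribute the second factor [w + h]. *)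
  assert (I1 : Rabs (RInt (fun s => (P s y - P s (y + h)) - (- (k * h))) x (x + w))
     <= (x + w - x) * (eps * (w + h))).
  { apply abs_RInt_le_const; [lra | apply ex_RInt_sub; [exact X1 | apply ex_RInt_const] |].
    intros s Hs. pose proof (E1 s y Hs ltac:(lra)) as F1.
    pose proof (E1 s (y + h) Hs ltac:(lra)) as F2.
    apply Rabs_le_between in F1. apply Rabs_le_between in F2. apply Rabs_le. lra. }
  assert (I2 : Rabs (RInt (fun t => (Q (x + w) t - Q x t) - k * w) y (y + h))
     <= (y + h - y) * (eps * (w + h))).
  { apply abs_RInt_le_const; [lra | apply ex_RInt_sub; [exact X2 | apply ex_RInt_const] |].
    intros t Ht. pose proof (E2 x t ltac:(lra) Ht) as F1.
    pose proof (E2 (x + w) t ltac:(lra) Ht) as F2.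
    apply Rabs_le_between in F1. apply Rabs_le_between in F2. apply Rabs_le. lra. }
  rewrite (RInt_sub _ (fun _ => - (k * h))), RInt_constant in I1
    by (exact X1 || apply ex_RInt_const).
  rewrite (RInt_sub _ (fun _ => k * w)), RInt_constant in I2
    by (exact X2 || apply ex_RInt_const).
  unfold loop_integral. apply Rabs_le_between in I1. apply Rabs_le_between in I2.
  apply Rabs_le. split; nra.
Qed.

(** Keeping a left or a right half makes the left ends increase and the right ends decrease, so the
    supremum of the left ends lies in every interval. *)
Lemma nested_intervals (x : nat -> R) (w : R) : 0 <= w ->
  (forall n, x (S n) = x n \/ x (S n) = x n + w / 2 ^ S n) ->
  exists p, forall n, x n <= p <= x n + w / 2 ^ n.
Proof.
  intros Hw Hx.
  assert (Hhalf : forall n, w / 2 ^ n = w / 2 ^ S n + w / 2 ^ S n).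
  { intros n. simpl. field. apply pow_nonzero. lra. }
  assert (Hpos : forall n, 0 <= w / 2 ^ n).
  { intros n. apply Rdiv_le_0_compat; [exact Hw | apply pow_lt; lra]. }
  assert (Hmono : forall n k, x n <= x (n + k)%nat /\
    x (n + k)%nat + w / 2 ^ (n + k) <= x n + w / 2 ^ n).
  { intros n k. induction k as [| k IH].
    - rewrite Nat.add_0_r. lra.
    - rewrite Nat.add_succ_r. pose proof (Hhalf (n + k)%nat).
      pose proof (Hpos (S (n + k))). destruct (Hx (n + k)%nat) as [-> | ->]; lra. }
  assert (Hup : forall n m, x m <= x n + w / 2 ^ n).
  { intros n m. destruct (Nat.le_ge_cases n m) as [H | H].
    - destruct (Hmono n (m - n)%nat) as [_ H2].
      replace (n + (m - n))%nat with m in H2 by lia. pose proof (Hpos m). lra.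
    - destruct (Hmono m (n - m)%nat) as [H2 _].
      replace (m + (n - m))%nat with n in H2 by lia. pose proof (Hpos n). lra. }
  destruct (completeness (fun r => exists n, r = x n)) as [p [Hp1 Hp2]].
  - exists (x 0%nat + w / 2 ^ 0). intros r [m ->]. apply Hup.
  - exists (x 0%nat), 0%nat. reflexivity.
  - exists p. intros n. split.
    + apply Hp1. exists n. reflexivity.
    + apply Hp2. intros r [m ->]. apply Hup.
Qed.

(** The circulations around the four quarters add up to the whole, and each quarter is allowed
    exactly a quarter of the bound, so they cannot all respect it. *)
Lemma loop_integral_quarters (x y w h M : R) :
  xmin <= x -> x + w <= xmax -> ymin <= y -> y + h <= ymax ->
  0 <= w -> 0 <= h -> M * (w + h) ^ 2 < Rabs (loop_integral P Q x (x + w) y (y + h)) ->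
  exists x' y', (x' = x \/ x' = x + w / 2) /\ (y' = y \/ y' = y + h / 2) /\
    M * (w / 2 + h / 2) ^ 2 < Rabs (loop_integral P Q x' (x' + w / 2) y' (y' + h / 2)).
Proof.
  intros Hx Hxw Hy Hyh Hw Hh Hbig. apply NNPP. intros Hno.
  assert (Hq : forall x' y', (x' = x \/ x' = x + w / 2) -> (y' = y \/ y' = y + h / 2) ->
    Rabs (loop_integral P Q x' (x' + w / 2) y' (y' + h / 2)) <= M * (w / 2 + h / 2) ^ 2).
  { intros x' y' H1 H2. apply Rnot_lt_le. intros H3. apply Hno. exists x', y'. auto. }
  rewrite (loop_integral_split_fst x (x + w / 2)) in Hbig by lra.
  rewrite (loop_integral_split_snd x (x + w / 2) y (y + h / 2)) in Hbig by lra.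
  rewrite (loop_integral_split_snd (x + w / 2) (x + w) y (y + h / 2)) in Hbig by lra.
  pose proof (Hq x y ltac:(auto) ltac:(auto)) as Q1.
  pose proof (Hq x (y + h / 2) ltac:(auto) ltac:(auto)) as Q2.
  pose proof (Hq (x + w / 2) y ltac:(auto) ltac:(auto)) as Q3.
  pose proof (Hq (x + w / 2) (y + h / 2) ltac:(auto) ltac:(auto)) as Q4.
  replace (x + w / 2 + w / 2) with (x + w) in Q3, Q4 by field.
  replace (y + h / 2 + h / 2) with (y + h) in Q2, Q4 by field.
  apply Rabs_le_between in Q1, Q2, Q3, Q4.
  revert Hbig. apply Rle_not_lt, Rabs_le.
  replace (M * (w + h) ^ 2) with (4 * (M * (w / 2 + h / 2) ^ 2)) by field. lra.
Qed.

Lemma goursat : xmin <= xmax -> ymin <= ymax -> loop_integral P Q xmin xmax ymin ymax = 0.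
Proof.
  intros HAB HCD. set (W := xmax - xmin). set (H := ymax - ymin).
  assert (Hsmall : forall eps, 0 < eps ->
    Rabs (loop_integral P Q xmin xmax ymin ymax) <= eps * (W + H) ^ 2).
  { intros eps Heps. apply Rnot_lt_le. intros Hbad.
    set (bad := fun (n : nat) (z : R * R) =>
      xmin <= fst z /\ fst z + W / 2 ^ n <= xmax /\ ymin <= snd z /\ snd z + H / 2 ^ n <= ymax /\
      eps * (W / 2 ^ n + H / 2 ^ n) ^ 2 <
      Rabs (loop_integral P Q (fst z) (fst z + W / 2 ^ n) (snd z) (snd z + H / 2 ^ n))).
    assert (Hhalf : forall w n, w / 2 ^ n / 2 = w / 2 ^ S n).
    { intros w n. simpl. field. apply pow_nonzero. lra. }
    assert (Hpos : forall w n, 0 <= w -> 0 <= w / 2 ^ n).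
    { intros w n Hw. apply Rdiv_le_0_compat; [exact Hw | apply pow_lt; lra]. }
    (* The hypothesis [bad n z] sits inside the existential so that choice yields a total function
       [next]. *)
    assert (Hstep : forall n z, exists z', bad n z -> bad (S n) z' /\
      (fst z' = fst z \/ fst z' = fst z + W / 2 ^ S n) /\
      (snd z' = snd z \/ snd z' = snd z + H / 2 ^ S n)).
    { intros n z. destruct (classic (bad n z)) as [Hb | Hb]; [| exists z; tauto].
      destruct Hb as [B1 [B2 [B3 [B4 B5]]]].
      pose proof (Hpos W n ltac:(unfold W; lra)) as PW.
      pose proof (Hpos H n ltac:(unfold H; lra)) as PH.
      destruct (loop_integral_quarters _ _ _ _ eps B1 B2 B3 B4 PW PH B5)
        as [x' [y' [Hx' [Hy' Hb']]]].
      exists (x', y'). intros _. rewrite !Hhalf in *. unfold bad; simpl fst; simpl snd.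
      pose proof (Hhalf W n). pose proof (Hhalf H n).
      repeat split; try assumption; destruct Hx', Hy'; subst; lra. }
    set (next := fun n z => proj1_sig (constructive_indefinite_description _ (Hstep n z))).
    assert (Hnext : forall n z, bad n z -> bad (S n) (next n z) /\
      (fst (next n z) = fst z \/ fst (next n z) = fst z + W / 2 ^ S n) /\
      (snd (next n z) = snd z \/ snd (next n z) = snd z + H / 2 ^ S n)).
    { intros n z. exact (proj2_sig (constructive_indefinite_description _ (Hstep n z))). }
    set (z := fix z n := match n with O => (xmin, ymin) | S n => next n (z n) end).
    assert (Hz : forall n, bad n (z n)).
    { induction n as [| n IH].
      - unfold bad; simpl. rewrite !Rdiv_1_r.
        replace (xmin + W) with xmax by (unfold W; ring).
        replace (ymin + H) with ymax by (unfold H; ring).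
        repeat split; lra || exact Hbad.
      - simpl. apply Hnext, IH. }
    destruct (nested_intervals (fun n => fst (z n)) W) as [u Hu]; [unfold W; lra | |].
    { intros n. apply (Hnext n (z n) (Hz n)). }
    destruct (nested_intervals (fun n => snd (z n)) H) as [v Hv]; [unfold H; lra | |].
    { intros n. apply (Hnext n (z n) (Hz n)). }
    assert (Huv : xmin <= u <= xmax /\ ymin <= v <= ymax).
    { pose proof (Hu 0%nat) as H1. pose proof (Hv 0%nat) as H2. simpl in H1, H2.
      rewrite Rdiv_1_r in H1, H2. unfold W, H in *. lra. }
    destruct (loop_integral_local u v eps (proj1 Huv) (proj2 Huv) Heps) as [d [Hd Hloc]].
    (* The summand 1 keeps the numerator positive when the rectangle is degenerate. *)
    assert (Hn : exists n, (W + H + 1) / 2 ^ n < d).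
    { destruct (pow_lt_1_zero (/ 2)) with (y := d / (W + H + 1)) as [n Hn].
      - rewrite Rabs_pos_eq; lra.
      - apply Rdiv_lt_0_compat; unfold W, H; lra.
      - exists n. specialize (Hn n (le_n n)).
        rewrite Rabs_pos_eq, pow_inv in Hn by (apply pow_le; lra).
        assert (Hp : 0 < W + H + 1) by (unfold W, H; lra).
        apply Rmult_lt_compat_l with (r := W + H + 1) in Hn; [| exact Hp].
        replace ((W + H + 1) * (d / (W + H + 1))) with d in Hn by (field; lra). exact Hn. }
    destruct Hn as [n Hn]. destruct (Hz n) as [B1 [B2 [B3 [B4 B5]]]].
    revert B5. apply Rle_not_lt.
    assert (HW : 0 <= W / 2 ^ n) by (apply Hpos; unfold W; lra).
    assert (HH : 0 <= H / 2 ^ n) by (apply Hpos; unfold H; lra).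
    assert (H1 : 0 <= 1 / 2 ^ n) by (apply Hpos; lra).
    assert (HS : (W + H + 1) / 2 ^ n = W / 2 ^ n + H / 2 ^ n + 1 / 2 ^ n)
      by (field; apply pow_nonzero; lra).
    apply Hloc; try assumption; try lra; [apply Hu | apply Hv]. }
  destruct (Req_dec (loop_integral P Q xmin xmax ymin ymax) 0) as [E | E]; [exact E |].
  apply Rabs_pos_lt in E.
  assert (HS : 0 <= (W + H) ^ 2) by apply pow2_ge_0.
  (* With this [eps] the bound [eps * (W + H) ^ 2] is less than the circulation's own modulus, a
     contradiction. *)
  specialize (Hsmall (Rabs (loop_integral P Q xmin xmax ymin ymax) / (2 * ((W + H) ^ 2 + 1)))).
  assert (Hp : 0 < Rabs (loop_integral P Q xmin xmax ymin ymax) / (2 * ((W + H) ^ 2 + 1))).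
  { apply Rdiv_lt_0_compat; lra. }
  specialize (Hsmall Hp).
  assert (Rabs (loop_integral P Q xmin xmax ymin ymax) / (2 * ((W + H) ^ 2 + 1))
    * (2 * ((W + H) ^ 2 + 1))
    = Rabs (loop_integral P Q xmin xmax ymin ymax)) by (field; lra).
  nra.
Qed.

End Goursat.

(** * The mean value property *)

Lemma differentiable_pt_lim_snd (g : R -> R) (x y l : R) :
  derivable_pt_lim g y l -> differentiable_pt_lim (fun _ v => g v) x y 0 l.
Proof.
  intros H eps. destruct (H eps (cond_pos eps)) as [d Hd].
  exists d. intros u v _ Hv.
  eapply Rle_trans; [| apply Rmult_le_compat_l; [apply Rlt_le, cond_pos | apply Rmax_r]].
  destruct (Req_dec (v - y) 0) as [E | E].
  - replace v with y by lra. rewrite !Rminus_diag.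
    replace (0 - (0 * (u - x) + l * 0)) with 0 by ring. rewrite Rabs_R0. lra.
  - specialize (Hd (v - y) E Hv). replace (y + (v - y)) with v in Hd by ring.
    replace (g v - g y - (0 * (u - x) + l * (v - y)))
      with (((g v - g y) / (v - y) - l) * (v - y)) by (field; exact E).
    rewrite Rabs_mult. apply Rmult_le_compat_r; [apply Rabs_pos | lra].
Qed.

Lemma differentiable_pt_lim_Rmult (x y : R) : differentiable_pt_lim Rmult x y y x.
Proof.
  intros eps. exists eps. intros u v Hu _.
  replace (u * v - x * y - (y * (u - x) + x * (v - y))) with ((u - x) * (v - y)) by ring.
  rewrite Rabs_mult. apply Rmult_le_compat; try apply Rabs_pos; [lra | apply Rmax_r].
Qed.

Lemma differentiable_pt_lim_shift (f : R -> R -> R) (c x y lx ly : R) :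
  differentiable_pt_lim f x y lx ly -> differentiable_pt_lim (fun u v => c + f u v) x y lx ly.
Proof.
  intros H eps. destruct (H eps) as [d Hd]. exists d. intros u v Hu Hv.
  replace (c + f u v - (c + f x y)) with (f u v - f x y) by ring. auto.
Qed.

Lemma differentiable_pt_lim_mult (f g : R -> R -> R) (x y fx fy gx gy : R) :
  differentiable_pt_lim f x y fx fy -> differentiable_pt_lim g x y gx gy ->
  differentiable_pt_lim (fun u v => f u v * g u v) x y
    (g x y * fx + f x y * gx) (g x y * fy + f x y * gy).
Proof.
  intros Hf Hg.
  apply (differentiable_pt_lim_comp Rmult f g x y); try assumption.
  apply differentiable_pt_lim_Rmult.
Qed.

(** The Cauchy-Riemann equations, in the form of the real matrix of multiplication by [l]. *)
Lemma differentiable_pt_lim_cderiv (f : C -> C) (z l : C) : cderiv f z l ->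
  differentiable_pt_lim (fun x y => Re (f (x, y))) (Re z) (Im z) (Re l) (- Im l) /\
  differentiable_pt_lim (fun x y => Im (f (x, y))) (Re z) (Im z) (Im l) (Re l).
Proof.
  intros H.
  assert (Hmain : forall eps : posreal, locally_2d (fun x y =>
    Cmod (f (x, y) - f z - l * ((x, y) - z)) <= eps * Rmax (Rabs (x - Re z)) (Rabs (y - Im z)))
    (Re z) (Im z)).
  { intros eps. destruct (H (eps / 2)) as [d [Hd Hz]]; [apply is_pos_div_2 |].
    assert (Hd2 : 0 < d / 2) by lra. exists (mkposreal _ Hd2). simpl. intros x y Hx Hy.
    set (w := ((x, y) - z)%C).
    (* The true factor is the square root of 2; rounding it up to 2 is paid for by [eps / 2]. *)
    assert (Hw : Cmod w <= 2 * Rmax (Rabs (x - Re z)) (Rabs (y - Im z))).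
    { eapply Rle_trans; [apply Cmod_2Rmax |]. apply Rmult_le_compat_r.
      - eapply Rle_trans; [apply Rabs_pos | apply Rmax_l].
      - rewrite <- (sqrt_square 2) at 2 by lra. apply sqrt_le_1_alt. lra. }
    replace (f (x, y) - f z - l * w)%C with (w * (slope f z l (x, y) - slope f z l z))%C.
    - rewrite Cmod_mult.
      assert (Hwd : Cmod w < d).
      { eapply Rle_lt_trans; [exact Hw |].
        apply Rlt_le_trans with (2 * (d / 2)); [| lra].
        apply Rmult_lt_compat_l; [lra |]. apply Rmax_lub_lt; assumption. }
      specialize (Hz (x, y) Hwd).
      apply Rle_trans with (2 * Rmax (Rabs (x - Re z)) (Rabs (y - Im z)) * (eps / 2));
        [| right; field].
      apply Rmult_le_compat; [apply Cmod_ge_0 | apply Cmod_ge_0 | exact Hw | apply Rlt_le, Hz].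
    - rewrite (slope_at f z l). rewrite (slope_eq f z l (x, y)) at 1. fold w. ring. }
  split; intros eps; destruct (Hmain eps) as [d Hd]; exists d; intros x y Hx Hy;
    (eapply Rle_trans; [| exact (Hd x y Hx Hy)]).
  - replace (_ - _ - _) with (Re (f (x, y) - f z - l * ((x, y) - z))%C);
      [apply re_le_Cmod |].
    destruct z, l; unfold Re, Im, Cminus, Cplus, Copp, Cmult; simpl. ring.
  - replace (_ - _ - _) with (Im (f (x, y) - f z - l * ((x, y) - z))%C).
    + eapply Rle_trans; [| apply Rmax_Cmod]. apply Rmax_r.
    + destruct z, l; unfold Re, Im, Cminus, Cplus, Copp, Cmult; simpl. ring.
Qed.

(** Given by coordinates so that both partial derivatives can be read off; [circ_eq] recovers the
    complex form. *)
Definition circ (a : C) (r t : R) : C := (Re a + r * cos t, Im a + r * sin t).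

Lemma circ_eq (a : C) (r t : R) : circ a r t = (a + r * cis t)%C.
Proof.
  destruct a. unfold circ, cis, Re, Im, Cplus, Cmult, RtoC; simpl. f_equal; ring.
Qed.

Lemma Cmod_cis (t : R) : Cmod (cis t) = 1.
Proof.
  unfold Cmod, cis; simpl. replace (_ + _) with 1; [apply sqrt_1 |].
  pose proof (sin2_cos2 t) as H. unfold Rsqr in H. lra.
Qed.

Lemma Cmod_circ (a : C) (r t : R) : 0 <= r -> Cmod (circ a r t - a) = r.
Proof.
  intros Hr. rewrite circ_eq. replace (a + r * cis t - a)%C with (r * cis t)%C by ring.
  rewrite Cmod_mult, Cmod_cis, Cmod_R, Rabs_pos_eq by exact Hr. ring.
Qed.

Lemma circ_0 (a : C) (t : R) : circ a 0 t = a.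
Proof. rewrite circ_eq. ring. Qed.

Lemma circ_2PI (a : C) (r : R) : circ a r (2 * PI) = circ a r 0.
Proof. unfold circ. rewrite cos_2PI, sin_2PI, cos_0, sin_0. reflexivity. Qed.

Lemma differentiable_circ (a : C) (r t : R) :
  differentiable_pt_lim (fun u v => Re (circ a u v)) r t (cos t) (- (r * sin t)) /\
  differentiable_pt_lim (fun u v => Im (circ a u v)) r t (sin t) (r * cos t).
Proof.
  assert (Hid : differentiable_pt_lim (fun u _ : R => u) r t 1 0).
  { apply (differentiable_pt_lim_proj1_0 (fun u => u)). apply derivable_pt_lim_id. }
  split; simpl; apply differentiable_pt_lim_shift.
  - replace (cos t) with (cos t * 1 + r * 0) by ring.
    replace (- (r * sin t)) with (cos t * 0 + r * - sin t) by ring.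
    apply (differentiable_pt_lim_mult (fun u _ => u) (fun _ v => cos v)); [exact Hid |].
    apply differentiable_pt_lim_snd, derivable_pt_lim_cos.
  - replace (sin t) with (sin t * 1 + r * 0) by ring.
    replace (r * cos t) with (sin t * 0 + r * cos t) by ring.
    apply (differentiable_pt_lim_mult (fun u _ => u) (fun _ v => sin v)); [exact Hid |].
    apply differentiable_pt_lim_snd, derivable_pt_lim_sin.
Qed.

Lemma Cmod_le_Rabs (z : C) : Cmod z <= Rabs (Re z) + Rabs (Im z).
Proof.
  destruct z as [x y]. simpl. replace (Cmod (x, y)) with (Cmod (x + Ci * y)).
  - eapply Rle_trans; [apply Cmod_triangle |].
    rewrite Cmod_mult, Cmod_Ci, !Cmod_R, Rmult_1_l. apply Rle_refl.
  - f_equal. unfold Ci, Cplus, Cmult, RtoC; simpl. f_equal; ring.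
Qed.

Lemma im_le_Cmod (z : C) : Rabs (Im z) <= Cmod z.
Proof. eapply Rle_trans; [apply Rmax_r | apply Rmax_Cmod]. Qed.

Lemma continuity_2d_circ (f : C -> C) (a : C) (r t : R) : ccont f (circ a r t) ->
  continuity_2d_pt (fun u v => Re (f (circ a u v))) r t /\
  continuity_2d_pt (fun u v => Im (f (circ a u v))) r t.
Proof.
  intros H. destruct (differentiable_circ a r t) as [HX HY].
  assert (CX : continuity_2d_pt (fun u v => Re (circ a u v)) r t)
    by (apply differentiable_continuity_pt; eexists; eexists; exact HX).
  assert (CY : continuity_2d_pt (fun u v => Im (circ a u v)) r t)
    by (apply differentiable_continuity_pt; eexists; eexists; exact HY).
  assert (Hmain : forall eps : posreal, locally_2d (fun u v =>
    Cmod (f (circ a u v) - f (circ a r t)) < eps) r t).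
  { intros eps. destruct (H eps (cond_pos eps)) as [d [Hd Hf]].
    assert (Hd2 : 0 < d / 2) by lra.
    destruct (CX (mkposreal _ Hd2)) as [d1 H1]. destruct (CY (mkposreal _ Hd2)) as [d2 H2].
    simpl in H1, H2. exists (mkposreal _ (Rmin_pos _ _ (cond_pos d1) (cond_pos d2))). simpl.
    intros u v Hu Hv. pose proof (Rmin_l d1 d2). pose proof (Rmin_r d1 d2).
    apply Hf. eapply Rle_lt_trans; [apply Cmod_le_Rabs |].
    specialize (H1 u v ltac:(lra) ltac:(lra)). specialize (H2 u v ltac:(lra) ltac:(lra)).
    change (Rabs (Re (circ a u v) - Re (circ a r t)) +
      Rabs (Im (circ a u v) - Im (circ a r t)) < d). simpl in *. lra. }
  split; intros eps; destruct (Hmain eps) as [d Hd]; exists d; intros u v Hu Hv;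
    (eapply Rle_lt_trans; [| exact (Hd u v Hu Hv)]).
  - apply (re_le_Cmod (f (circ a u v) - f (circ a r t))%C).
  - apply (im_le_Cmod (f (circ a u v) - f (circ a r t))%C).
Qed.

(** Here [g r] will be an integral over the circle of radius [r]. It is constant between exceptional
    radii; continuity glues the two ranges at [s] and extends the value to the centre. *)
Lemma constant_off_point (g : R -> R) (B s : R) :
  (forall r, 0 <= r < B -> forall eps, 0 < eps -> exists delta, 0 < delta /\
    forall r', 0 <= r' < B -> Rabs (r' - r) < delta -> Rabs (g r' - g r) < eps) ->
  (forall r1 r2, 0 < r1 -> r1 <= r2 -> r2 < B -> r2 < s \/ s < r1 -> g r1 = g r2) ->
  forall r, 0 <= r < B -> g r = g 0.
Proof.
  intros Hc Hg.
  assert (Happ : forall c v, 0 <= c < B -> (forall d, 0 < d -> exists r', 0 <= r' < B /\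
    Rabs (r' - c) < d /\ g r' = v) -> v = g c).
  { intros c v Hcb Hv. apply NNPP. intros Hne.
    destruct (Hc c Hcb (Rabs (v - g c))) as [d [Hd H]]; [apply Rabs_pos_lt; lra |].
    destruct (Hv d Hd) as [r' [Hr' [Hr'd <-]]]. specialize (H r' Hr' Hr'd). lra. }
  assert (Hlow : forall r, 0 < r < B -> r < s \/ s <= 0 -> g r = g 0).
  { intros r Hr Hrs. apply Happ; [lra |]. intros d Hd.
    exists (Rmin r (d / 2)). pose proof (Rmin_l r (d / 2)). pose proof (Rmin_r r (d / 2)).
    assert (0 < Rmin r (d / 2)) by (apply Rmin_pos; lra).
    repeat split; try lra.
    - rewrite Rabs_pos_eq; lra.
    - apply Hg; lra. }
  intros r Hr. destruct (Req_dec r 0) as [-> | Hr0]; [reflexivity |].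
  destruct (Rlt_or_le r s) as [Hrs | Hrs]; [apply Hlow; lra |].
  destruct (Rle_or_lt s 0) as [Hs0 | Hs0]; [apply Hlow; lra |].
  assert (Es : g 0 = g s).
  { apply Happ; [lra |]. intros d Hd. exists (Rmax (s / 2) (s - d / 2)).
    pose proof (Rmax_l (s / 2) (s - d / 2)). pose proof (Rmax_r (s / 2) (s - d / 2)).
    assert (Rmax (s / 2) (s - d / 2) < s) by (apply Rmax_lub_lt; lra).
    repeat split; try lra.
    - apply Rabs_def1; lra.
    - apply Hlow; lra. }
  rewrite Es. destruct (Req_dec r s) as [-> | Hne]; [reflexivity |].
  apply Happ; [lra |]. intros d Hd. exists (Rmin r (s + d / 2)).
  pose proof (Rmin_l r (s + d / 2)). pose proof (Rmin_r r (s + d / 2)).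
  assert (s < Rmin r (s + d / 2)) by (apply Rmin_glb_lt; lra).
  repeat split; try lra.
  - rewrite Rabs_pos_eq; lra.
  - apply Hg; lra.
Qed.

(** On the rectangle of polar coordinates the edges [t = 0] and [t = 2 * PI] describe the same
    segment and cancel. What remains of the zero circulation is the difference of the two circle
    integrals. *)
Lemma RInt_circle_eq (f : C -> C) (a : C) (r1 r2 : R) : 0 < r1 -> r1 <= r2 ->
  (forall z, r1 <= Cmod (z - a) <= r2 -> cdiff f z) ->
  RInt (fun t => Re (f (circ a r1 t))) 0 (2 * PI) =
  RInt (fun t => Re (f (circ a r2 t))) 0 (2 * PI).
Proof.
  intros Hr1 Hr12 Hf. pose proof PI_RGT_0 as Hpi.
  (* By the Cauchy-Riemann equations, [P dr + Q dt] is closed. *)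
  set (P := fun r t => Im (f (circ a r t)) * / r).
  set (Q := fun r t => Re (f (circ a r t))).
  assert (Hclosed : forall x y, r1 <= x <= r2 -> 0 <= y <= 2 * PI ->
    exists p k q, differentiable_pt_lim P x y p k /\ differentiable_pt_lim Q x y k q).
  { intros r t Hr _. destruct (Hf (circ a r t)) as [l Hl].
    { rewrite Cmod_circ; lra. }
    apply differentiable_pt_lim_cderiv in Hl. destruct Hl as [HRe HIm].
    destruct (differentiable_circ a r t) as [HX HY].
    pose proof (differentiable_pt_lim_comp _ _ _ _ _ _ _ _ _ _ _ HRe HX HY) as HQ.
    pose proof (differentiable_pt_lim_comp _ _ _ _ _ _ _ _ _ _ _ HIm HX HY) as HV.
    assert (Hinv : differentiable_pt_lim (fun u _ : R => / u) r t (- / (r ^ 2)) 0).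
    { apply (differentiable_pt_lim_proj1_0 (fun u => / u)).
      apply is_derive_Reals. auto_derive; [lra | field; lra]. }
    pose proof (differentiable_pt_lim_mult _ _ _ _ _ _ _ _ HV Hinv) as HP.
    eexists; exists (Re l * cos t + - Im l * sin t); eexists; split; [| exact HQ].
    match type of HP with differentiable_pt_lim _ _ _ _ ?k =>
      replace (Re l * cos t + - Im l * sin t) with k by (cbv beta; field; lra) end.
    exact HP. }
  pose proof (goursat P Q r1 r2 0 (2 * PI) Hclosed Hr12 ltac:(lra)) as H.
  unfold loop_integral in H.
  rewrite (RInt_ext (fun x => P x 0 - P x (2 * PI)) (fun _ => 0)) in H.
  2: { intros x _. unfold P. rewrite circ_2PI. apply Rminus_diag_eq. reflexivity. }
  rewrite RInt_constant, RInt_sub in H.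
  - unfold Q in H. lra.
  - apply (ex_RInt_closed_form_snd P Q r1 r2 0 (2 * PI) Hclosed); lra.
  - apply (ex_RInt_closed_form_snd P Q r1 r2 0 (2 * PI) Hclosed); lra.
Qed.

(** The circle of radius [s] is where [f] may be merely continuous, as a slope based at a point of
    that circle is. A caller without such a circle passes [-1]. *)
Lemma mean_value_Re (f : C -> C) (a : C) (B s : R) :
  (forall z, Cmod (z - a) < B -> ccont f z) ->
  (forall z, 0 < Cmod (z - a) < B -> Cmod (z - a) <> s -> cdiff f z) ->
  forall r, 0 <= r < B -> RInt (fun t => Re (f (circ a r t))) 0 (2 * PI) = 2 * PI * Re (f a).
Proof.
  intros Hc Hd r Hr. pose proof PI_RGT_0 as Hpi.
  assert (Hc2 : forall r, 0 <= r < B -> forall t,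
    continuity_2d_pt (fun u v => Re (f (circ a u v))) r t).
  { intros r' Hr' t. apply continuity_2d_circ, Hc. rewrite Cmod_circ; lra. }
  assert (Hex : forall r, 0 <= r < B -> ex_RInt (fun t => Re (f (circ a r t))) 0 (2 * PI)).
  { intros r' Hr'. apply (ex_RInt_continuous (V := R_CompleteNormedModule)).
    intros t _. apply (continuity_2d_pt_snd (fun u v => Re (f (circ a u v)))), Hc2, Hr'. }
  rewrite (constant_off_point (fun r => RInt (fun t => Re (f (circ a r t))) 0 (2 * PI)) B s).
  - rewrite (RInt_ext _ (fun _ => Re (f a))).
    + rewrite RInt_constant. apply Rmult_eq_compat_r, Rminus_0_r.
    + intros t _. rewrite circ_0. reflexivity.
  - intros c Hcb eps Heps.
    (* Integrated over length [2 * PI] this gives [eps / 2], strictly below [eps]. *)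
    assert (He : 0 < eps / (4 * PI)) by (apply Rdiv_lt_0_compat; lra).
    destruct (uniform_continuity_2d_1d' (fun u v => Re (f (circ a u v))) 0 (2 * PI) c
      (fun t _ => Hc2 c Hcb t) (mkposreal _ He)) as [d Hunif]. simpl in Hunif.
    exists d. split; [apply cond_pos |]. intros r' Hr' Hr'd.
    apply Rabs_def2 in Hr'd.
    rewrite <- RInt_sub by auto.
    apply Rle_lt_trans with ((2 * PI - 0) * (eps / (4 * PI))).
    + apply abs_RInt_le_const; [lra | apply ex_RInt_sub; auto |].
      intros t Ht. apply Rlt_le, Hunif; try lra. rewrite Rminus_diag, Rabs_R0. apply cond_pos.
    + replace ((2 * PI - 0) * (eps / (4 * PI))) with (eps / 2) by (field; lra). lra.
  - intros r1 r2 Hr1 Hr12 Hr2 Hs. apply RInt_circle_eq; try assumption.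
    intros z Hz. apply Hd; lra.
  - exact Hr.
Qed.

Definition CInt (g : R -> C) : C :=
  (RInt (fun t => Re (g t)) 0 (2 * PI), RInt (fun t => Im (g t)) 0 (2 * PI)).

Lemma mean_value (f : C -> C) (a : C) (B s : R) :
  (forall z, Cmod (z - a) < B -> ccont f z) ->
  (forall z, 0 < Cmod (z - a) < B -> Cmod (z - a) <> s -> cdiff f z) ->
  forall r, 0 <= r < B -> CInt (fun t => f (circ a r t)) = (2 * PI * f a)%C.
Proof.
  intros Hc Hd r Hr. unfold CInt.
  rewrite (mean_value_Re f a B s Hc Hd r Hr).
  (* The imaginary part is the real part of [- Ci * f], to which the same result applies. *)
  rewrite (RInt_ext (fun t => Im (f (circ a r t))) (fun t => Re (- Ci * f (circ a r t)))).
  - rewrite (mean_value_Re (fun z => - Ci * f z)%C a B s).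
    + destruct (f a). unfold Re, Im, Ci, RtoC, Cmult, Copp; simpl. f_equal; ring.
    + intros z Hz. apply ccont_mult; [apply ccont_const | auto].
    + intros z Hz Hs. apply cdiff_mult; [apply cdiff_const | auto].
    + exact Hr.
  - intros t _. destruct (f (circ a r t)). unfold Re, Im, Ci, Cmult, Copp; simpl. ring.
Qed.

(** * Cauchy's formula and the maximum principle *)

Lemma RtoC_neq (x : R) : x <> 0 -> RtoC x <> 0%C.
Proof. intros H E. apply H, RtoC_inj, E. Qed.

Definition pcont (g : R -> C) : Prop :=
  forall t, continuous (fun t => Re (g t)) t /\ continuous (fun t => Im (g t)) t.

Lemma pcont_ex_RInt (g : R -> C) (a b : R) : pcont g ->
  ex_RInt (fun t => Re (g t)) a b /\ ex_RInt (fun t => Im (g t)) a b.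
Proof.
  intros H. split; apply (ex_RInt_continuous (V := R_CompleteNormedModule));
    intros t _; apply H.
Qed.

Lemma pcont_circ (f : C -> C) (a : C) (r : R) : 0 <= r ->
  (forall z, Cmod (z - a) = r -> ccont f z) -> pcont (fun t => f (circ a r t)).
Proof.
  intros Hr H t. destruct (continuity_2d_circ f a r t) as [H1 H2].
  - apply H, Cmod_circ, Hr.
  - split.
    + apply (continuity_2d_pt_snd (fun u v => Re (f (circ a u v)))), H1.
    + apply (continuity_2d_pt_snd (fun u v => Im (f (circ a u v)))), H2.
Qed.

Lemma CInt_ext (g h : R -> C) : (forall t, g t = h t) -> CInt g = CInt h.
Proof.
  intros H. unfold CInt. f_equal; apply RInt_ext; intros t _; rewrite H; reflexivity.
Qed.

Lemma CInt_plus (g h : R -> C) : pcont g -> pcont h ->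
  CInt (fun t => (g t + h t)%C) = (CInt g + CInt h)%C.
Proof.
  intros Hg Hh.
  destruct (pcont_ex_RInt g 0 (2 * PI) Hg), (pcont_ex_RInt h 0 (2 * PI) Hh).
  unfold CInt, Cplus; simpl. f_equal; apply RInt_add; assumption.
Qed.

Lemma RInt_scalar (c : R) (f : R -> R) (a b : R) : ex_RInt f a b ->
  RInt (fun t => c * f t) a b = c * RInt f a b.
Proof. exact (RInt_scal (V := R_CompleteNormedModule) f a b c). Qed.

Lemma ex_RInt_scalar (c : R) (f : R -> R) (a b : R) : ex_RInt f a b ->
  ex_RInt (fun t => c * f t) a b.
Proof. exact (ex_RInt_scal (V := R_NormedModule) f a b c). Qed.

Lemma CInt_scal (c : C) (g : R -> C) : pcont g ->
  CInt (fun t => (c * g t)%C) = (c * CInt g)%C.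
Proof.
  intros Hg. destruct (pcont_ex_RInt g 0 (2 * PI) Hg) as [H1 H2].
  unfold CInt, Cmult; simpl. f_equal.
  - rewrite <- !RInt_scalar, <- RInt_sub by (assumption || (apply ex_RInt_scalar; assumption)).
    reflexivity.
  - rewrite <- !RInt_scalar, <- RInt_add by (assumption || (apply ex_RInt_scalar; assumption)).
    reflexivity.
Qed.

Lemma CInt_conj (g : R -> C) : pcont g -> CInt (fun t => Cconj (g t)) = Cconj (CInt g).
Proof.
  intros Hg. destruct (pcont_ex_RInt g 0 (2 * PI) Hg) as [H1 H2].
  assert (E : RInt (fun t => Im (Cconj (g t))) 0 (2 * PI)
    = -1 * RInt (fun t => Im (g t)) 0 (2 * PI)).
  { rewrite <- RInt_scalar by exact H2. apply RInt_ext. intros t _.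
    change (- Im (g t) = -1 * Im (g t)). ring. }
  unfold CInt at 1. rewrite E. unfold CInt, Cconj; simpl. f_equal. lra.
Qed.

Lemma pcont_scal (c : C) (g : R -> C) : pcont g -> pcont (fun t => (c * g t)%C).
Proof.
  intros Hg t. destruct (Hg t) as [H1 H2]. unfold Cmult; simpl. split.
  - apply (continuous_minus (V := R_NormedModule)
      (fun t => Re c * Re (g t)) (fun t => Im c * Im (g t)));
      apply (continuous_mult (K := R_AbsRing)); (apply continuous_const || assumption).
  - apply (continuous_plus (V := R_NormedModule)
      (fun t => Re c * Im (g t)) (fun t => Im c * Re (g t)));
      apply (continuous_mult (K := R_AbsRing)); (apply continuous_const || assumption).
Qed.

(** Multiplying by the conjugate of the integral makes it real, so a real estimate suffices without
    loss. Bounding the two components separately would cost a factor of the square root of 2. *)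
Lemma CInt_bound (g : R -> C) (M : R) : pcont g ->
  (forall t, 0 <= t <= 2 * PI -> Cmod (g t) <= M) -> Cmod (CInt g) <= 2 * PI * M.
Proof.
  intros Hg HM. pose proof PI_RGT_0 as Hpi.
  pose proof (CInt_scal (Cconj (CInt g)) g Hg) as E.
  apply (f_equal Re) in E.
  replace (Cconj (CInt g) * CInt g)%C with (RtoC (Cmod (CInt g) ^ 2)) in E
    by (rewrite Cmod2_conj; ring).
  rewrite re_RtoC in E.
  change (RInt (fun t => Re (Cconj (CInt g) * g t)) 0 (2 * PI) = Cmod (CInt g) ^ 2) in E.
  generalize dependent (CInt g). intros w E.
  assert (H : Rabs (RInt (fun t => Re (Cconj w * g t)) 0 (2 * PI))
    <= (2 * PI - 0) * (Cmod w * M)).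
  { destruct (pcont_ex_RInt _ 0 (2 * PI) (pcont_scal (Cconj w) g Hg)) as [Hi _].
    apply abs_RInt_le_const; [lra | exact Hi |].
    intros t Ht. eapply Rle_trans; [apply re_le_Cmod |].
    rewrite Cmod_mult, Cmod_conj. apply Rmult_le_compat_l; [apply Cmod_ge_0 | auto]. }
  rewrite E in H. apply Rabs_le_between in H.
  destruct (Rle_lt_or_eq_dec 0 (Cmod w) (Cmod_ge_0 _)) as [Hp | <-].
  - apply Rmult_le_reg_l with (Cmod w); [exact Hp |]. nra.
  - assert (0 <= M) by (eapply Rle_trans; [apply Cmod_ge_0 | apply (HM 0); lra]). nra.
Qed.

Lemma slope_cdiff_off (f : C -> C) (a l z : C) : z <> a -> cdiff f z -> cdiff (slope f a l) z.
Proof.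
  intros Hza Hf.
  apply (cdiff_ext_loc (fun w => ((f w - f a) * / (w - a))%C) _ z (Cmod (z - a))).
  - apply Cmod_sub_gt_0, Hza.
  - intros w Hw. rewrite slope_neq; [reflexivity |]. intros ->.
    rewrite Cmod_sub_sym in Hw. lra.
  - apply cdiff_mult.
    + apply cdiff_minus; [exact Hf | apply cdiff_const].
    + apply cdiff_inv; [apply cdiff_minus; [apply cdiff_id | apply cdiff_const] |].
      apply Csub_neq_0, Hza.
Qed.

Lemma slope_ccont_off (f : C -> C) (a l z : C) : z <> a -> ccont f z -> ccont (slope f a l) z.
Proof.
  intros Hza Hf.
  apply (ccont_ext_loc (fun w => ((f w - f a) * / (w - a))%C) _ z (Cmod (z - a))).
  - apply Cmod_sub_gt_0, Hza.
  - intros w Hw. rewrite slope_neq; [reflexivity |]. intros ->.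
    rewrite Cmod_sub_sym in Hw. lra.
  - apply ccont_mult.
    + apply ccont_minus; [exact Hf | apply ccont_const].
    + apply ccont_inv; [apply ccont_minus; [apply ccont_id | apply ccont_const] |].
      apply Csub_neq_0, Hza.
Qed.

Lemma Cmod_gt_sub_neq (a z w : C) : Cmod (z - a) < Cmod (w - a) -> w <> z.
Proof. intros H ->. lra. Qed.

Lemma ccont_quotient (a b z : C) : z <> b -> ccont (fun w => ((w - a) / (w - b))%C) z.
Proof.
  intros H. apply ccont_mult.
  - apply ccont_minus; [apply ccont_id | apply ccont_const].
  - apply ccont_inv; [| apply Csub_neq_0, H].
    apply ccont_minus; [apply ccont_id | apply ccont_const].
Qed.

(* On the circle [|w - a| = r] the conjugate of [(w - a) / (w - z)] is
   [1 / (1 - conj (z - a) (w - a) / r ^ 2)], which is holomorphic on a larger disk. *)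
Lemma CInt_cauchy_kernel (a z : C) (r : R) : Cmod (z - a) < r ->
  CInt (fun t => ((circ a r t - a) / (circ a r t - z))%C) = RtoC (2 * PI).
Proof.
  intros Hz. pose proof (Cmod_ge_0 (z - a)) as Hz0.
  (* The reflected pole lies at distance [r ^ 2 / Cmod (z - a)], which is meaningless for [z = a];
     the positive [m] gives a radius [r ^ 2 / m] that still exceeds [r]. *)
  set (m := (Cmod (z - a) + r) / 2). assert (Hm : 0 < m < r) by (unfold m; lra).
  assert (Hpc : pcont (fun t => ((circ a r t - a) / (circ a r t - z))%C)).
  { apply (pcont_circ (fun w => ((w - a) / (w - z))%C)); [lra |]. intros w Hw.
    apply ccont_quotient, (Cmod_gt_sub_neq a). lra. }
  assert (Hneq : forall w, Cmod (w - a) < r ^ 2 / m ->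
    (1 - Cconj (z - a) * (w - a) / RtoC (r ^ 2))%C <> 0%C).
  { intros w Hw H.
    assert (E : (Cconj (z - a) * (w - a))%C = RtoC (r ^ 2)).
    { replace (Cconj (z - a) * (w - a))%C
        with ((1 - (1 - Cconj (z - a) * (w - a) / RtoC (r ^ 2))) * RtoC (r ^ 2))%C.
      - rewrite H. ring.
      - field. apply RtoC_neq. apply pow_nonzero. lra. }
    apply (f_equal Cmod) in E. rewrite Cmod_mult, Cmod_conj, Cmod_R in E.
    rewrite Rabs_pos_eq in E by apply pow2_ge_0.
    assert (Cmod (w - a) * m < r ^ 2).
    { apply Rmult_lt_compat_r with (r := m) in Hw; [| lra].
      replace (r ^ 2 / m * m) with (r ^ 2) in Hw by (field; lra). exact Hw. }
    assert (Cmod (z - a) <= m) by (unfold m; lra).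
    pose proof (Cmod_ge_0 (w - a)). nra. }
  assert (Hd : forall w, Cmod (w - a) < r ^ 2 / m ->
    cdiff (fun w => (/ (1 - Cconj (z - a) * (w - a) / RtoC (r ^ 2)))%C) w).
  { intros w Hw. apply cdiff_inv; [| apply Hneq, Hw].
    apply cdiff_minus; [apply cdiff_const |].
    apply cdiff_mult; [| apply cdiff_const]. apply cdiff_mult; [apply cdiff_const |].
    apply cdiff_minus; [apply cdiff_id | apply cdiff_const]. }
  assert (Hr : 0 <= r < r ^ 2 / m).
  { split; [lra |]. apply Rmult_lt_reg_r with m; [lra |].
    replace (r ^ 2 / m * m) with (r * r) by (field; lra). nra. }
  assert (E : CInt (fun t => Cconj ((circ a r t - a) / (circ a r t - z))) = RtoC (2 * PI)).
  { rewrite (CInt_ext _ (fun t =>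
      (/ (1 - Cconj (z - a) * (circ a r t - a) / RtoC (r ^ 2)))%C)).
    - rewrite (mean_value (fun w => (/ (1 - Cconj (z - a) * (w - a) / RtoC (r ^ 2)))%C) a
        (r ^ 2 / m) (-1)).
      + assert (E0 : (1 - Cconj (z - a) * (a - a) / RtoC (r ^ 2))%C = 1%C).
        { field. apply RtoC_neq, pow_nonzero. lra. }
        rewrite E0, RtoC_mult. field.
      + intros w Hw. apply cdiff_ccont, Hd, Hw.
      + intros w Hw _. apply Hd. lra.
      + exact Hr.
    - intros t. pose proof (Cmod_circ a r t ltac:(lra)) as Hc.
      set (w := circ a r t) in *.
      assert (E1 : ((w - a) * Cconj (w - a))%C = RtoC (r ^ 2)).
      { rewrite <- Cmod2_conj, Hc. reflexivity. }
      pose proof (Hneq w ltac:(lra)) as Hn.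
      assert (Hwz : (w - z)%C <> 0%C) by (apply Csub_neq_0, (Cmod_gt_sub_neq a); lra).
      assert (Hwa : (w - a)%C <> 0%C) by (apply Cmod_gt_0; lra).
      assert (Hcwz : Cconj (w - z) <> 0%C).
      { apply Cmod_gt_0. rewrite Cmod_conj. apply Cmod_gt_0, Hwz. }
      unfold Cdiv at 1. rewrite Cmult_conj, Cinv_conj by exact Hwz.
      assert (Hrr : RtoC (r ^ 2) <> 0%C) by (apply RtoC_neq, pow_nonzero; lra).
      replace (Cconj (z - a)) with (Cconj (w - a) - Cconj (w - z))%C in Hn |- *
        by (rewrite !Cminus_conj; ring).
      replace (1 - (Cconj (w - a) - Cconj (w - z)) * (w - a) / RtoC (r ^ 2))%C
        with (Cconj (w - z) * (w - a) / RtoC (r ^ 2))%C in Hn |- *.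
      + rewrite <- E1 in *. field.
        repeat split; try assumption.
        intros H0. apply Hrr. rewrite H0. ring.
      + transitivity ((RtoC (r ^ 2) - ((w - a) * Cconj (w - a)) + Cconj (w - z) * (w - a))
          / RtoC (r ^ 2))%C.
        * rewrite E1. field. exact Hrr.
        * field. exact Hrr. }
  rewrite CInt_conj in E by exact Hpc.
  rewrite <- (Cconj_conj (CInt _)), E. unfold Cconj, RtoC; simpl. f_equal. ring.
Qed.

Section PuncturedDisk.

Variables (f : C -> C) (a : C) (B : R).

Hypothesis f_cont : forall z, Cmod (z - a) < B -> ccont f z.
Hypothesis f_diff : forall z, 0 < Cmod (z - a) < B -> cdiff f z.

Lemma pcont_circle_mult (g : C -> C) (r : R) : 0 <= r < B ->
  (forall z, Cmod (z - a) = r -> ccont g z) ->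
  pcont (fun t => (f (circ a r t) * g (circ a r t))%C).
Proof.
  intros Hr Hg. apply (pcont_circ (fun w => (f w * g w)%C)); [lra |].
  intros w Hw. apply ccont_mult; [apply f_cont; lra | auto].
Qed.

(** The function [(w - a) * slope f z l w] vanishes at [a], so its circle integral is 0 by the mean
    value property; expanding the slope leaves the Cauchy integral minus [f z] times the kernel
    integral. *)
Lemma cauchy_formula (r : R) (z : C) : Cmod (z - a) < r < B ->
  CInt (fun t => (f (circ a r t) * ((circ a r t - a) / (circ a r t - z)))%C) = (2 * PI * f z)%C.
Proof.
  intros Hz. pose proof (Cmod_ge_0 (z - a)) as Hz0.
  (* At [z = a] no derivative is assumed; there the factor [w - a] cancels the pole of the slope,
     whatever [l] is. *)
  assert (Hl : exists l, z <> a -> cderiv f z l).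
  { destruct (Ceq_dec z a) as [H | H]; [exists 0%C; congruence |].
    destruct (f_diff z) as [l Hl]; [| exists l; auto].
    split; [apply Cmod_sub_gt_0, H | lra]. }
  destruct Hl as [l Hl].
  assert (E : CInt (fun t => ((circ a r t - a) * slope f z l (circ a r t))%C) = 0%C).
  { rewrite (mean_value (fun w => (w - a) * slope f z l w)%C a B (Cmod (z - a))).
    - ring.
    - intros w Hw. destruct (Ceq_dec w z) as [-> | Hwz].
      + destruct (Ceq_dec z a) as [Ez | Hza].
        * apply (ccont_ext_loc (fun w => (f w - f z)%C) _ z 1); [lra | |].
          { intros w' _. rewrite (slope_eq f z l w') at 1. rewrite Ez. ring. }
          { apply ccont_minus; [apply f_cont, Hw | apply ccont_const]. }
        * apply ccont_mult; [| exact (Hl Hza)].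
          apply ccont_minus; [apply ccont_id | apply ccont_const].
      + apply ccont_mult; [| apply slope_ccont_off; [exact Hwz | apply f_cont, Hw]].
        apply ccont_minus; [apply ccont_id | apply ccont_const].
    - intros w Hw Hs. apply cdiff_mult.
      + apply cdiff_minus; [apply cdiff_id | apply cdiff_const].
      + apply slope_cdiff_off; [congruence | apply f_diff, Hw].
    - lra. }
  assert (Hk : forall w, Cmod (w - a) = r -> ccont (fun w => ((w - a) / (w - z))%C) w).
  { intros w Hw. apply ccont_quotient, (Cmod_gt_sub_neq a). lra. }
  assert (P1 : pcont (fun t => (f (circ a r t) * ((circ a r t - a) / (circ a r t - z)))%C)).
  { apply (pcont_circle_mult (fun w => ((w - a) / (w - z))%C)); [lra | exact Hk]. }
  assert (P2 : pcont (fun t => ((circ a r t - a) / (circ a r t - z))%C)).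
  { apply (pcont_circ (fun w => ((w - a) / (w - z))%C)); [lra | exact Hk]. }
  rewrite (CInt_ext _ (fun t => (f (circ a r t) * ((circ a r t - a) / (circ a r t - z))
    + - f z * ((circ a r t - a) / (circ a r t - z)))%C)) in E.
  - rewrite CInt_plus, CInt_scal, CInt_cauchy_kernel, RtoC_mult in E;
      [| lra | exact P2 | exact P1 | apply pcont_scal, P2].
    match type of E with (?I + _)%C = _ =>
      replace I with (I + - f z * (2 * PI) + (2 * PI * f z))%C by ring end.
    rewrite E. ring.
  - intros t. pose proof (Cmod_circ a r t ltac:(lra)).
    assert (circ a r t <> z) by (apply (Cmod_gt_sub_neq a); lra).
    rewrite slope_neq by assumption. field. apply Csub_neq_0. assumption.
Qed.

Lemma cauchy_bound (r M : R) (z : C) : Cmod (z - a) < r < B ->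
  (forall t, 0 <= t <= 2 * PI -> Cmod (f (circ a r t)) <= M) ->
  Cmod (f z) <= M * (r / (r - Cmod (z - a))).
Proof.
  intros Hz HM. pose proof (Cmod_ge_0 (z - a)) as Hz0. pose proof PI_RGT_0 as Hpi.
  pose proof (cauchy_formula r z Hz) as E. apply (f_equal Cmod) in E.
  rewrite Cmod_mult, <- RtoC_mult, Cmod_R, Rabs_pos_eq in E by lra.
  apply Rmult_le_reg_l with (2 * PI); [lra |]. rewrite <- E. apply CInt_bound.
  - apply (pcont_circle_mult (fun w => ((w - a) / (w - z))%C)); [lra |].
    intros w Hw. apply ccont_quotient, (Cmod_gt_sub_neq a). lra.
  - intros t Ht. pose proof (Cmod_circ a r t ltac:(lra)) as Hc.
    rewrite Cmod_mult, Cmod_div, Hc by (apply Csub_neq_0, (Cmod_gt_sub_neq a); lra).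
    apply Rmult_le_compat; [apply Cmod_ge_0 | | auto |].
    + apply Rdiv_le_0_compat; [lra |].
      apply Cmod_gt_0, Csub_neq_0, (Cmod_gt_sub_neq a). lra.
    + apply Rmult_le_compat_l; [lra |]. apply Rinv_le_contravar; [lra |].
      pose proof (Cmod_triangle_inv (circ a r t - a) (z - a)) as H.
      replace (circ a r t - a - (z - a))%C with (circ a r t - z)%C in H by ring. lra.
Qed.

Lemma circle_bounded (r : R) : 0 <= r < B ->
  exists M, 0 < M /\ forall t, 0 <= t <= 2 * PI -> Cmod (f (circ a r t)) <= M.
Proof.
  intros Hr. pose proof PI_RGT_0 as Hpi.
  assert (Hp : pcont (fun t => f (circ a r t))).
  { apply pcont_circ; [lra |]. intros w Hw. apply f_cont. lra. }
  set (u := fun t => Re (f (circ a r t))). set (v := fun t => Im (f (circ a r t))).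
  destruct (continuity_ab_maj (fun t => u t * u t + v t * v t) 0 (2 * PI))
    as [t0 [Ht0 _]]; [lra | |].
  { intros t _. destruct (Hp t) as [H1 H2].
    apply continuity_pt_filterlim in H1, H2.
    apply (continuity_pt_plus (fun t => u t * u t) (fun t => v t * v t));
      apply continuity_pt_mult; assumption. }
  set (V := u t0 * u t0 + v t0 * v t0) in Ht0.
  assert (HV : 0 <= V) by (unfold V; nra).
  (* [V] bounds the squared modulus, and [V + 1] dominates the square root of [V]. *)
  exists (V + 1). split; [lra |].
  intros t Ht. specialize (Ht0 t Ht).
  replace (u t * u t + v t * v t) with (Cmod (f (circ a r t)) ^ 2) in Ht0
    by (rewrite Cmod2_alt; unfold u, v; ring).
  pose proof (Cmod_ge_0 (f (circ a r t))). nra.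
Qed.

End PuncturedDisk.

(* The constant [r / (r - |z - a|)] of the Cauchy bound disappears by applying
   it to the powers of [f]. *)
Lemma maximum_principle (f : C -> C) (a : C) (B r M : R) (z : C) :
  (forall z, Cmod (z - a) < B -> ccont f z) ->
  (forall z, 0 < Cmod (z - a) < B -> cdiff f z) ->
  Cmod (z - a) < r < B ->
  (forall t, 0 <= t <= 2 * PI -> Cmod (f (circ a r t)) <= M) ->
  Cmod (f z) <= M.
Proof.
  intros Hc Hd Hz HM. pose proof (Cmod_ge_0 (z - a)) as Hz0. pose proof PI_RGT_0 as Hpi.
  assert (HM0 : 0 <= M) by (eapply Rle_trans; [apply Cmod_ge_0 | apply (HM 0); lra]).
  set (K := r / (r - Cmod (z - a))).
  assert (HK : 0 < K) by (apply Rdiv_lt_0_compat; lra).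
  assert (Hn : forall n, Cmod (f z) ^ n <= M ^ n * K).
  { intros n. rewrite <- Cmod_pow.
    apply (cauchy_bound (fun w => (f w ^ n)%C) a B).
    - intros w Hw. apply ccont_pow, Hc, Hw.
    - intros w Hw. apply cdiff_pow, Hd, Hw.
    - exact Hz.
    - intros t Ht. rewrite Cmod_pow. apply pow_incr. split; [apply Cmod_ge_0 | auto]. }
  apply Rnot_lt_le. intros Hlt.
  destruct (Rle_lt_or_eq_dec 0 M HM0) as [Hp | <-].
  - set (q := Cmod (f z) / M).
    assert (Hq : 1 < q).
    { apply Rmult_lt_reg_r with M; [exact Hp |]. unfold q.
      replace (Cmod (f z) / M * M) with (Cmod (f z)) by (field; lra). lra. }
    destruct (Pow_x_infinity q) with (b := K + 1) as [N HN].
    { rewrite Rabs_pos_eq; lra. }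
    specialize (HN N (le_n N)). rewrite Rabs_pos_eq in HN by (apply pow_le; lra).
    specialize (Hn N).
    replace (Cmod (f z)) with (q * M) in Hn by (unfold q; field; lra).
    rewrite Rpow_mult_distr in Hn.
    assert (0 < M ^ N) by (apply pow_lt; lra). nra.
  - specialize (Hn 1%nat). simpl in Hn. lra.
Qed.

(** [L] is Cauchy's integral for the derivative at [a]. Expanding the kernel to second order in
    [z - a] gives [f z = f a + (z - a) * L] up to a remainder of size [Cmod (z - a) ^ 2]. *)
Lemma removable_singularity (f : C -> C) (a : C) (B : R) : 0 < B ->
  (forall z, Cmod (z - a) < B -> ccont f z) ->
  (forall z, 0 < Cmod (z - a) < B -> cdiff f z) -> cdiff f a.
Proof.
  intros HB Hc Hd. pose proof PI_RGT_0 as Hpi.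
  set (r := B / 2). assert (Hr : 0 < r < B) by (unfold r; lra).
  destruct (circle_bounded f a B Hc r) as [M [HM0 HM]]; [lra |].
  assert (Hpi2 : RtoC (2 * PI) <> 0%C) by (apply RtoC_neq; lra).
  assert (Hoff : forall w, Cmod (w - a) = r -> (w - a)%C <> 0%C)
    by (intros w Hw; apply Cmod_gt_0; lra).
  assert (Csub : forall b w, ccont (fun w => (w - b)%C) w).
  { intros b w. apply ccont_minus; [apply ccont_id | apply ccont_const]. }
  set (L := (CInt (fun t => f (circ a r t) * / (circ a r t - a)) / RtoC (2 * PI))%C).
  assert (Hslope : forall z, 0 < Cmod (z - a) < r / 2 ->
    Cmod (slope f a L z - L) <= Cmod (z - a) * (2 * M / r ^ 2)).
  { intros z Hz.
    assert (Hza : (z - a)%C <> 0%C) by (apply Cmod_gt_0; lra).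
    set (g := fun w => (/ ((w - a) * (w - z)))%C).
    assert (Hwz : forall w, Cmod (w - a) = r -> (w - z)%C <> 0%C)
      by (intros w Hw; apply Csub_neq_0, (Cmod_gt_sub_neq a); lra).
    assert (Hg : forall w, Cmod (w - a) = r -> ccont g w).
    { intros w Hw. apply ccont_inv; [apply ccont_mult; apply Csub |].
      apply Cmult_neq_0; auto. }
    assert (P0 : pcont (fun t => f (circ a r t))).
    { apply pcont_circ; [lra |]. intros w Hw. apply Hc. lra. }
    assert (P1 : pcont (fun t => (f (circ a r t) * / (circ a r t - a))%C)).
    { apply (pcont_circle_mult f a B Hc (fun w => (/ (w - a))%C)); [lra |].
      intros w Hw. apply ccont_inv; [apply Csub | auto]. }
    assert (P2 : pcont (fun t => (f (circ a r t) * g (circ a r t))%C)).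
    { apply (pcont_circle_mult f a B Hc g); [lra | exact Hg]. }
    pose proof (cauchy_formula f a B Hc Hd r z ltac:(lra)) as E.
    (* The three terms are the orders 0, 1 and 2 of the kernel; the first integrates to the value at
       [a], the second to [L]. *)
    rewrite (CInt_ext _ (fun t => (f (circ a r t)
      + ((z - a) * (f (circ a r t) * / (circ a r t - a))
      + ((z - a) * (z - a)) * (f (circ a r t) * g (circ a r t))))%C)) in E.
    2: { intros t. pose proof (Cmod_circ a r t ltac:(lra)) as Hw. unfold g. field.
      split; auto. }
    rewrite !CInt_plus, !CInt_scal in E; try assumption.
    2, 3: apply pcont_scal; assumption.
    2: { intros t. destruct (pcont_scal (z - a) _ P1 t) as [A1 A2].
      destruct (pcont_scal ((z - a) * (z - a)) _ P2 t) as [A3 A4].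
      split.
      - exact (continuous_plus (V := R_NormedModule) _ _ t A1 A3).
      - exact (continuous_plus (V := R_NormedModule) _ _ t A2 A4). }
    rewrite (mean_value f a B (-1) Hc (fun w Hw _ => Hd w Hw) r ltac:(lra)) in E.
    rewrite <- RtoC_mult in E.
    assert (Es : (slope f a L z - L)%C
      = ((z - a) / RtoC (2 * PI) * CInt (fun t => f (circ a r t) * g (circ a r t)))%C).
    { rewrite slope_neq by (intros ->; apply Hza; ring).
      replace (f z) with ((RtoC (2 * PI) * f z) / RtoC (2 * PI))%C by (field; exact Hpi2).
      rewrite <- E. unfold L. field. repeat split; assumption. }
    rewrite Es, Cmod_mult, Cmod_div by exact Hpi2.
    rewrite Cmod_R, Rabs_pos_eq by lra.
    apply Rle_trans with (Cmod (z - a) / (2 * PI) * (2 * PI * (2 * M / r ^ 2))).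
    - apply Rmult_le_compat_l; [apply Rdiv_le_0_compat; lra |].
      apply CInt_bound; [exact P2 |]. intros t Ht.
      pose proof (Cmod_circ a r t ltac:(lra)) as Hw. unfold g.
      rewrite Cmod_mult, Cmod_inv, Cmod_mult, Hw by (apply Cmult_neq_0; auto).
      assert (Hlow : r / 2 <= Cmod (circ a r t - z)).
      { pose proof (Cmod_triangle_inv (circ a r t - a) (z - a)) as H.
        replace (circ a r t - a - (z - a))%C with (circ a r t - z)%C in H by ring. lra. }
      replace (2 * M / r ^ 2) with (M * / (r * (r / 2))) by (field; lra).
      apply Rmult_le_compat; [apply Cmod_ge_0 | | auto |].
      + apply Rlt_le, Rinv_0_lt_compat, Rmult_lt_0_compat; lra.
      + apply Rinv_le_contravar; [apply Rmult_lt_0_compat; lra |].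
        apply Rmult_le_compat_l; lra.
    - right. field. split; lra. }
  exists L. intros eps Heps.
  assert (HK : 0 < 2 * M / r ^ 2) by (apply Rdiv_lt_0_compat; [lra | apply pow_lt; lra]).
  exists (Rmin (r / 2) (eps / (2 * M / r ^ 2))).
  split; [apply Rmin_pos; [lra | apply Rdiv_lt_0_compat; assumption] |].
  intros z Hz. pose proof (Rmin_l (r / 2) (eps / (2 * M / r ^ 2))).
  pose proof (Rmin_r (r / 2) (eps / (2 * M / r ^ 2))).
  rewrite slope_at. destruct (Ceq_dec z a) as [-> | Hza].
  - rewrite slope_at, Cmod_sub_self. exact Heps.
  - eapply Rle_lt_trans; [apply Hslope |].
    + split; [apply Cmod_sub_gt_0, Hza | lra].
    + apply Rlt_le_trans with (eps / (2 * M / r ^ 2) * (2 * M / r ^ 2)).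
      * apply Rmult_lt_compat_r; [exact HK | lra].
      * right. field. lra.
Qed.

(** * Local theory of holomorphic functions *)

(** The slope is continuous at [a] and differentiable elsewhere, so its singularity is removable.
    Iterating this extracts powers of [z - a] as a Taylor expansion would. *)
Lemma slope_cdiff (f : C -> C) (a l : C) (B : R) : 0 < B ->
  (forall z, Cmod (z - a) < B -> cdiff f z) -> cderiv f a l ->
  forall z, Cmod (z - a) < B -> cdiff (slope f a l) z.
Proof.
  intros HB Hf Hl z Hz. destruct (Ceq_dec z a) as [-> | Hza].
  - apply (removable_singularity _ a B HB).
    + intros w Hw. destruct (Ceq_dec w a) as [-> | Hwa]; [exact Hl |].
      apply slope_ccont_off; [exact Hwa | apply cdiff_ccont, Hf, Hw].
    + intros w Hw. apply slope_cdiff_off; [| apply Hf, Hw].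
      intros ->. rewrite Cmod_sub_self in Hw. lra.
  - apply slope_cdiff_off; [exact Hza | apply Hf, Hz].
Qed.

(** The maximum principle for the slope, whose value at [a] is [l]; the factor 2 comes from the
    difference of two values of [f]. *)
Lemma cauchy_estimate (f : C -> C) (a l : C) (B r M : R) : 0 < r < B ->
  (forall z, Cmod (z - a) < B -> cdiff f z) -> cderiv f a l ->
  (forall z, Cmod (z - a) < B -> Cmod (f z) <= M) -> Cmod l <= 2 * M / r.
Proof.
  intros Hr Hf Hl HM. rewrite <- (slope_at f a l).
  apply (maximum_principle _ a B r).
  - intros z Hz. apply cdiff_ccont, (slope_cdiff f a l B); try assumption. lra.
  - intros z Hz. apply (slope_cdiff f a l B); try assumption; lra.
  - rewrite Cmod_sub_self. exact Hr.
  - intros t _. pose proof (Cmod_circ a r t ltac:(lra)) as Hc.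
    assert (Hne : circ a r t <> a) by (intros E; rewrite E, Cmod_sub_self in Hc; lra).
    rewrite slope_neq, Cmod_div, Hc by (assumption || apply Csub_neq_0, Hne).
    apply Rmult_le_compat_r; [apply Rlt_le, Rinv_0_lt_compat; lra |].
    pose proof (HM (circ a r t) ltac:(lra)).
    pose proof (HM a ltac:(rewrite Cmod_sub_self; lra)).
    pose proof (Cmod_triangle (f (circ a r t)) (- f a)) as H1. rewrite Cmod_opp in H1.
    unfold Cminus. lra.
Qed.

(** Two slopes give [f z = f a + (z - a) * d a + (z - a) ^ 2 * f2 z]. Differentiating this at [z]
    expresses [d z] through [f2] and its derivative, and the Cauchy estimate bounds the latter near
    [a]; the slope of [d] thus tends to [2 * f2 a]. *)
Lemma cderiv_cdiff (f d : C -> C) (a : C) (B : R) : 0 < B ->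
  (forall z, Cmod (z - a) < B -> cderiv f z (d z)) -> cdiff d a.
Proof.
  intros HB Hd.
  assert (Ha : Cmod (a - a) < B) by (rewrite Cmod_sub_self; exact HB).
  pose proof (Hd a Ha) as H0.
  set (f1 := slope f a (d a)).
  assert (Hf1 : forall z, Cmod (z - a) < B -> cdiff f1 z).
  { apply slope_cdiff; [exact HB | | exact H0]. intros z Hz. exists (d z). auto. }
  destruct (Hf1 a Ha) as [l2 Hl2].
  set (f2 := slope f1 a l2).
  assert (Hf2 : forall z, Cmod (z - a) < B -> cdiff f2 z).
  { apply slope_cdiff; assumption. }
  assert (Hlin : forall w, cderiv (fun z => (z - a)%C) w 1).
  { intros w. apply (cderiv_ext_loc (fun z => (z + - a)%C) _ w 1 1); [lra | reflexivity |].
    pose proof (cderiv_plus _ _ w _ _ (cderiv_id w) (cderiv_const (- a) w)) as H.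
    rewrite Cplus_0_r in H. exact H. }
  assert (Hexp : forall z m, Cmod (z - a) < B -> cderiv f2 z m ->
    d z = (d a + 2 * (z - a) * f2 z + (z - a) * (z - a) * m)%C).
  { intros z m Hz Hm. apply (cderiv_unique f z); [auto |].
    apply (cderiv_ext_loc
      (fun w => (f a + ((w - a) * d a + ((w - a) * (w - a)) * f2 w))%C) _ z _ 1); [lra | |].
    - intros w _. rewrite (slope_eq f a (d a) w). fold f1. rewrite (slope_eq f1 a l2 w).
      fold f2. unfold f1. rewrite slope_at. ring.
    - pose proof (cderiv_plus _ _ z _ _ (cderiv_const (f a) z)
        (cderiv_plus _ _ z _ _ (cderiv_mult _ _ z _ _ (Hlin z) (cderiv_const (d a) z))
        (cderiv_mult _ _ z _ _ (cderiv_mult _ _ z _ _ (Hlin z) (Hlin z)) Hm))) as H.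
      match type of H with cderiv _ _ ?k =>
        replace (d a + 2 * (z - a) * f2 z + (z - a) * (z - a) * m)%C with k by ring end.
      exact H. }
  pose proof (cdiff_ccont f2 a (Hf2 a Ha)) as Hc2.
  destruct (Hc2 1 Rlt_0_1) as [eta [Heta Hbd]].
  set (e := Rmin eta B). assert (He : 0 < e) by (apply Rmin_pos; assumption).
  assert (HeB : e <= B) by apply Rmin_r. assert (Heeta : e <= eta) by apply Rmin_l.
  set (M := Cmod (f2 a) + 1).
  assert (HM : forall w, Cmod (w - a) < e -> Cmod (f2 w) <= M).
  { intros w Hw. specialize (Hbd w ltac:(lra)).
    pose proof (Cmod_triangle_inv (f2 w) (f2 a)). unfold M. lra. }
  assert (HMp : 0 < M) by (unfold M; pose proof (Cmod_ge_0 (f2 a)); lra).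
  (* For [z] within [e / 2] of [a], the disk of radius [e / 2] around [z] stays where [f2] is
     bounded; the estimate uses the circle of radius [e / 4] in it. *)
  set (K := 2 * M / (e / 4)). assert (HK : 0 < K) by (apply Rdiv_lt_0_compat; lra).
  assert (Hm : forall z m, Cmod (z - a) < e / 2 -> cderiv f2 z m -> Cmod m <= K).
  { intros z m Hz Hzm. apply (cauchy_estimate f2 z m (e / 2) (e / 4) M); [lra | | exact Hzm |];
      intros w Hw; pose proof (Cmod_triangle_sub w z a); [apply Hf2 | apply HM]; lra. }
  exists (2 * f2 a)%C. intros eps Heps.
  destruct (Hc2 (eps / 4)) as [d1 [Hd1 H1]]; [lra |].
  set (d2 := eps / (2 * K)). assert (Hd2 : 0 < d2) by (apply Rdiv_lt_0_compat; lra).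
  exists (Rmin (Rmin d1 d2) (e / 2)).
  split; [repeat apply Rmin_pos; lra |]. intros z Hz.
  pose proof (Rmin_l (Rmin d1 d2) (e / 2)). pose proof (Rmin_r (Rmin d1 d2) (e / 2)).
  pose proof (Rmin_l d1 d2). pose proof (Rmin_r d1 d2).
  rewrite slope_at. destruct (Ceq_dec z a) as [-> | Hza].
  { rewrite slope_at, Cmod_sub_self. exact Heps. }
  destruct (Hf2 z ltac:(lra)) as [m Hzm].
  rewrite slope_neq, (Hexp z m) by (assumption || lra).
  replace ((d a + 2 * (z - a) * f2 z + (z - a) * (z - a) * m - d a) / (z - a) - 2 * f2 a)%C
    with (2 * (f2 z - f2 a) + (z - a) * m)%C by (field; apply Csub_neq_0, Hza).
  eapply Rle_lt_trans; [apply Cmod_triangle |]. rewrite !Cmod_mult, Cmod_R, Rabs_pos_eq by lra.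
  specialize (H1 z ltac:(lra)). specialize (Hm z m ltac:(lra) Hzm).
  assert (Cmod (z - a) * Cmod m <= eps / 2).
  { apply Rle_trans with (d2 * K).
    - apply Rmult_le_compat; try apply Cmod_ge_0; lra.
    - right. unfold d2. field. lra. }
  lra.
Qed.

(** A quantitative form of isolated zeros. If no quotient by a power of [z - a] were nonzero at [a],
    then [f] would be divisible by every power, and the maximum principle for the quotients would
    bound [Cmod (f z0)] by [M * q ^ k] with [q < 1] for all [k]. *)
Lemma order_lower_bound (f : C -> C) (a z0 : C) (B : R) :
  (forall z, Cmod (z - a) < B -> cdiff f z) -> Cmod (z0 - a) < B -> f z0 <> 0%C ->
  exists k c delta, 0 < c /\ 0 < delta /\
    forall z, Cmod (z - a) < delta -> c * Cmod (z - a) ^ k <= Cmod (f z).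
Proof.
  intros Hf Hz0 Hne. pose proof (Cmod_ge_0 (z0 - a)) as Hp.
  set (P := fun k psi => (forall z, Cmod (z - a) < B -> cdiff psi z) /\
    forall z, Cmod (z - a) < B -> f z = ((z - a) ^ k * psi z)%C).
  destruct (classic (exists k psi, P k psi /\ psi a <> 0%C)) as [[k [psi [[H1 H2] H3]]] | Hno].
  - destruct (ccont_neq_0 psi a) as [d [Hd Hlow]].
    { apply cdiff_ccont, H1. rewrite Cmod_sub_self. lra. }
    { exact H3. }
    apply Cmod_gt_0 in H3.
    exists k, (Cmod (psi a) / 2), (Rmin d B).
    split; [lra |]. split; [apply Rmin_pos; lra |]. intros z Hz.
    pose proof (Rmin_l d B). pose proof (Rmin_r d B).
    rewrite (H2 z) by lra. rewrite Cmod_mult, Cmod_pow, Rmult_comm.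
    apply Rmult_le_compat_l; [apply pow_le, Cmod_ge_0 | apply Rlt_le, Hlow; lra].
  - exfalso.
    assert (HP : forall k, exists psi, P k psi).
    { induction k as [| k [psi [H1 H2]]].
      - exists f. split; [exact Hf |]. intros z _. simpl. ring.
      - assert (Hpsi : psi a = 0%C).
        { apply NNPP. intros H. apply Hno. exists k, psi. repeat split; assumption. }
        destruct (H1 a) as [l Hl]; [rewrite Cmod_sub_self; lra |].
        exists (slope psi a l). split.
        + apply slope_cdiff; [lra | exact H1 | exact Hl].
        + intros z Hz. rewrite (H2 z Hz), (slope_eq psi a l z), Hpsi at 1. simpl. ring. }
    set (r := (Cmod (z0 - a) + B) / 2).
    assert (Hr : Cmod (z0 - a) < r < B) by (unfold r; lra).
    destruct (circle_bounded f a B) with (r := r) as [M [HM0 HM]]; [| lra |].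
    { intros z Hz. apply cdiff_ccont, Hf, Hz. }
    set (q := Cmod (z0 - a) / r).
    assert (Hq : 0 <= q < 1).
    { split; [apply Rdiv_le_0_compat; lra |]. apply Rmult_lt_reg_r with r; [lra |].
      unfold q. replace (Cmod (z0 - a) / r * r) with (Cmod (z0 - a)) by (field; lra). lra. }
    assert (Hk : forall k, Cmod (f z0) <= M * q ^ k).
    { intros k. destruct (HP k) as [psi [H1 H2]].
      assert (Hrk : 0 < r ^ k) by (apply pow_lt; lra).
      rewrite (H2 z0 Hz0), Cmod_mult, Cmod_pow.
      replace (M * q ^ k) with (Cmod (z0 - a) ^ k * (M / r ^ k)).
      - apply Rmult_le_compat_l; [apply pow_le; lra |].
        apply (maximum_principle psi a B r).
        + intros z Hz. apply cdiff_ccont, H1, Hz.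
        + intros z Hz. apply H1. lra.
        + exact Hr.
        + intros t Ht. specialize (HM t Ht). pose proof (Cmod_circ a r t ltac:(lra)) as Hc.
          rewrite (H2 (circ a r t)), Cmod_mult, Cmod_pow, Hc in HM by lra.
          apply Rmult_le_reg_l with (r ^ k); [exact Hrk |].
          replace (r ^ k * (M / r ^ k)) with M by (field; lra). exact HM.
      - unfold q, Rdiv. rewrite Rpow_mult_distr, pow_inv. ring. }
    apply Cmod_gt_0 in Hne.
    destruct (pow_lt_1_zero q) with (y := Cmod (f z0) / M) as [N HN].
    + rewrite Rabs_pos_eq; lra.
    + apply Rdiv_lt_0_compat; lra.
    + specialize (HN N (le_n N)). specialize (Hk N).
      rewrite Rabs_pos_eq in HN by (apply pow_le; lra).
      apply Rmult_lt_compat_l with (r := M) in HN; [| exact HM0].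
      replace (M * (Cmod (f z0) / M)) with (Cmod (f z0)) in HN by (field; lra). lra.
Qed.

(* If [f] omitted a value [w] close to [f a], then [1 / (f - w)] would be larger
   at the centre [a] than on a small circle around it. *)
Lemma open_mapping (f : C -> C) (a z0 : C) (B : R) :
  (forall z, Cmod (z - a) < B -> cdiff f z) -> Cmod (z0 - a) < B -> f z0 <> f a ->
  forall eps, 0 < eps -> exists delta, 0 < delta /\ forall w, Cmod (w - f a) < delta ->
    exists z, Cmod (z - a) < eps /\ Cmod (z - a) < B /\ f z = w.
Proof.
  intros Hf Hz0 Hne eps Heps. pose proof (Cmod_ge_0 (z0 - a)) as Hp.
  destruct (order_lower_bound (fun z => (f z - f a)%C) a z0 B) as [k [c [d [Hc [Hd Hlow]]]]].
  { intros z Hz. apply cdiff_minus; [auto | apply cdiff_const]. }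
  { exact Hz0. }
  { apply Csub_neq_0, Hne. }
  set (R0 := Rmin eps (Rmin B d)).
  assert (HR0 : 0 < R0) by (repeat apply Rmin_pos; lra).
  assert (HR1 : R0 <= eps) by apply Rmin_l.
  assert (HR2 : R0 <= Rmin B d) by apply Rmin_r.
  pose proof (Rmin_l B d). pose proof (Rmin_r B d).
  (* [m] bounds [f - f a] from below on the circle of radius [r]. For [w] within [m / 2] of [f a],
     the difference [f - w] is at least [m / 2] on that circle but smaller at the centre. *)
  set (r := R0 / 2). set (m := c * r ^ k).
  assert (Hm : 0 < m) by (apply Rmult_lt_0_compat; [lra | apply pow_lt; unfold r; lra]).
  exists (m / 2). split; [lra |]. intros w Hw. apply NNPP. intros Hno.
  assert (Hnw : forall z, Cmod (z - a) < R0 -> (f z - w)%C <> 0%C).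
  { intros z Hz. apply Csub_neq_0. intros E. apply Hno. exists z. repeat split; lra || exact E. }
  assert (Hdiff : forall z, Cmod (z - a) < R0 -> cdiff (fun z => (/ (f z - w))%C) z).
  { intros z Hz. apply cdiff_inv; [| auto].
    apply cdiff_minus; [apply Hf; lra | apply cdiff_const]. }
  assert (Ha : Cmod (a - a) < r) by (rewrite Cmod_sub_self; unfold r; lra).
  assert (Hmax : Cmod (/ (f a - w)) <= / (m / 2)).
  { apply (maximum_principle (fun z => (/ (f z - w))%C) a R0 r).
    - intros z Hz. apply cdiff_ccont, Hdiff, Hz.
    - intros z Hz. apply Hdiff. lra.
    - unfold r in *. lra.
    - intros t _. pose proof (Cmod_circ a r t ltac:(unfold r; lra)) as Hcirc.
      assert (HrR : r < R0) by (unfold r; lra).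
      rewrite Cmod_inv by (apply Hnw; lra).
      apply Rinv_le_contravar; [lra |].
      specialize (Hlow (circ a r t) ltac:(lra)). simpl in Hlow.
      rewrite Hcirc in Hlow. fold m in Hlow.
      pose proof (Cmod_triangle_sub (f (circ a r t)) w (f a)). lra. }
  assert (Hfa : (f a - w)%C <> 0%C) by (apply Hnw; unfold r in Ha; lra).
  rewrite Cmod_inv in Hmax by exact Hfa.
  apply Cmod_gt_0 in Hfa.
  apply Rinv_le_contravar in Hmax; [| apply Rinv_0_lt_compat, Hfa].
  rewrite !Rinv_inv, Cmod_sub_sym in Hmax. lra.
Qed.

(** The factor [c] selects a real-linear functional: 1 gives the real part and [- Ci] the imaginary
    part. *)
Lemma derivable_pt_lim_line (f : C -> C) (c p d l : C) (t : R) : cderiv f (p + t * d) l ->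
  derivable_pt_lim (fun s => Re (c * f (p + s * d)%C)) t (Re (c * l * d)).
Proof.
  intros H eps Heps.
  set (K := Cmod (c * d) + 1). pose proof (Cmod_ge_0 (c * d)) as Hcd.
  assert (HK : 0 < K) by (unfold K; lra).
  destruct (H (eps / K)) as [e [He Hs]]; [apply Rdiv_lt_0_compat; assumption |].
  pose proof (Cmod_ge_0 d) as Hd.
  assert (He2 : 0 < e / (Cmod d + 1)) by (apply Rdiv_lt_0_compat; lra).
  exists (mkposreal _ He2). intros h Hh0 Hh. simpl in Hh.
  set (w := (p + (t + h)%R * d)%C). set (z := (p + t * d)%C) in *.
  assert (Ew : (w - z)%C = (h * d)%C) by (unfold w, z; rewrite RtoC_plus; ring).
  replace ((Re (c * f w) - Re (c * f z)) / h - Re (c * l * d))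
    with (Re (c * d * (slope f z l w - slope f z l z))%C).
  - eapply Rle_lt_trans; [apply re_le_Cmod |]. rewrite Cmod_mult.
    assert (Hwz : Cmod (w - z) < e).
    { rewrite Ew, Cmod_mult, Cmod_R.
      apply Rle_lt_trans with (Rabs h * (Cmod d + 1)).
      - apply Rmult_le_compat_l; [apply Rabs_pos | lra].
      - apply Rmult_lt_compat_r with (r := Cmod d + 1) in Hh; [| lra].
        replace (e / (Cmod d + 1) * (Cmod d + 1)) with e in Hh by (field; lra). exact Hh. }
    specialize (Hs w Hwz).
    apply Rle_lt_trans with (Cmod (c * d) * (eps / K)).
    + apply Rmult_le_compat_l; lra.
    + apply Rlt_le_trans with (K * (eps / K)).
      * apply Rmult_lt_compat_r; [apply Rdiv_lt_0_compat; assumption | unfold K; lra].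
      * right. field. lra.
  - rewrite slope_at. rewrite (slope_eq f z l w) at 1. rewrite Ew.
    replace (c * (f z + h * d * slope f z l w))%C
      with (c * f z + h * (c * d * slope f z l w))%C by ring.
    replace (c * d * (slope f z l w - l))%C
      with (c * d * slope f z l w - c * l * d)%C by ring.
    generalize (c * f z)%C (c * d * slope f z l w)%C (c * l * d)%C. intros A1 A2 A3.
    change (Re A2 - Re A3 = (Re A1 + Re (h * A2) - Re A1) / h - Re A3).
    rewrite re_scal_l. field. exact Hh0.
Qed.

(** The mean value theorem fails for complex values, but holds after any fixed real functional; the
    uses choose [c] as a conjugate, so that a squared modulus appears. *)
Lemma mean_value_theorem_Re (f df : C -> C) (c p d : C) :
  (forall t : R, 0 <= t <= 1 -> cderiv f (p + t * d) (df (p + t * d)%C)) ->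
  exists t : R, 0 < t < 1 /\ Re (c * (f (p + d)%C - f p)) = Re (c * df (p + t * d)%C * d).
Proof.
  intros H.
  destruct (MVT_cor2 (fun s => Re (c * f (p + s * d)%C)) (fun s => Re (c * df (p + s * d)%C * d))
    0 1 Rlt_0_1) as [t [Ht Ht01]].
  { intros t Ht. apply derivable_pt_lim_line, H, Ht. }
  exists t. split; [exact Ht01 |].
  rewrite Rminus_0_r, Rmult_1_r in Ht. rewrite <- Ht.
  replace (p + 1 * d)%C with (p + d)%C by ring. replace (p + 0 * d)%C with p by ring.
  replace (c * (f (p + d)%C - f p))%C with (c * f (p + d)%C - c * f p)%C by ring. reflexivity.
Qed.

Lemma schwarz_lemma (q : C -> C) :
  (forall z, Cmod z < 1 -> cdiff q z) -> q 0%C = 0%C ->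
  (forall z, Cmod z < 1 -> Cmod (q z) <= 1) ->
  forall z, Cmod z < 1 -> Cmod (q z) <= Cmod z.
Proof.
  intros Hq Hq0 Hb z Hz.
  assert (Hsub : forall z, (z - 0)%C = z) by (intros; ring).
  assert (Hq' : forall z, Cmod (z - 0) < 1 -> cdiff q z)
    by (intros w Hw; apply Hq; rewrite Hsub in Hw; exact Hw).
  destruct (Hq 0%C) as [l Hl]; [rewrite Cmod_0; lra |].
  pose proof (slope_cdiff q 0 l 1 Rlt_0_1 Hq' Hl) as Hs.
  assert (Hr : forall r, Cmod z < r < 1 -> Cmod (slope q 0 l z) <= / r).
  { intros r Hr. pose proof (Cmod_ge_0 z) as Hz0. apply (maximum_principle _ 0%C 1 r).
    - intros w Hw. apply cdiff_ccont, Hs, Hw.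
    - intros w Hw. apply Hs. lra.
    - rewrite Hsub. exact Hr.
    - intros t _. pose proof (Cmod_circ 0 r t ltac:(lra)) as Hc. rewrite Hsub in Hc.
      assert (Hne : circ 0 r t <> 0%C) by (apply Cmod_gt_0; lra).
      rewrite slope_neq, Hq0, !Hsub, Cmod_div, Hc by assumption.
      unfold Rdiv. rewrite <- (Rmult_1_l (/ r)) at 2.
      apply Rmult_le_compat_r; [apply Rlt_le, Rinv_0_lt_compat; lra | apply Hb; lra]. }
  assert (H1 : Cmod (slope q 0 l z) <= 1).
  { apply Rnot_lt_le. intros H.
    set (s := Cmod (slope q 0 l z)) in *.
    pose proof (Cmod_ge_0 z) as Hz0.
    (* A radius beyond [/ s] gives a bound [/ r] below [s]; the maximum with [Cmod z] keeps [z]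
       inside the circle. *)
    set (r := (Rmax (Cmod z) (/ s) + 1) / 2).
    assert (Hs1 : / s < 1) by (rewrite <- Rinv_1; apply Rinv_lt_contravar; lra).
    assert (Hmax : Rmax (Cmod z) (/ s) < 1) by (apply Rmax_lub_lt; lra).
    pose proof (Rmax_l (Cmod z) (/ s)). pose proof (Rmax_r (Cmod z) (/ s)).
    specialize (Hr r ltac:(unfold r; lra)).
    assert (0 < / s) by (apply Rinv_0_lt_compat; lra).
    assert (Hsr : / s < r) by (unfold r; lra).
    apply Rinv_lt_contravar in Hsr; [| apply Rmult_lt_0_compat; lra].
    rewrite Rinv_inv in Hsr. lra. }
  rewrite (slope_eq q 0 l z), Hq0, Hsub, Cplus_0_l, Cmod_mult.
  pose proof (Cmod_ge_0 z). nra.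
Qed.

(** * Injective holomorphic functions *)

Section InjectiveHolomorphic.

Variables (f df : C -> C) (a : C) (B : R).

Hypothesis f_deriv : forall z, Cmod (z - a) < B -> cderiv f z (df z).
Hypothesis f_inj : forall z w, Cmod (z - a) < B -> Cmod (w - a) < B -> f z = f w -> z = w.

(** [epsilon] makes the inverse a total function; its values are determined only on the image of the
    disk. *)
Definition local_inverse (w : C) : C :=
  epsilon (inhabits (RtoC 0)) (fun z => Cmod (z - a) < B /\ f z = w).

Lemma local_inverse_spec (z : C) : Cmod (z - a) < B -> local_inverse (f z) = z.
Proof.
  intros Hz.
  assert (H : Cmod (local_inverse (f z) - a) < B /\ f (local_inverse (f z)) = f z).
  { unfold local_inverse. apply epsilon_spec. exists z. auto. }
  apply f_inj; tauto.
Qed.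

(** Injectivity supplies the second value of [f] near [b] that the open mapping theorem asks for. *)
Lemma injective_open (b : C) : Cmod (b - a) < B -> forall eps, 0 < eps ->
  exists delta, 0 < delta /\ forall w, Cmod (w - f b) < delta ->
    exists z, Cmod (z - b) < eps /\ Cmod (z - a) < B /\ f z = w.
Proof.
  intros Hb eps Heps.
  assert (Hin : forall z, Cmod (z - b) < B - Cmod (b - a) -> Cmod (z - a) < B).
  { intros z Hz. pose proof (Cmod_triangle_sub z b a). lra. }
  set (h := (B - Cmod (b - a)) / 2). assert (Hh : 0 < h) by (unfold h; lra).
  assert (Hz0 : Cmod (b + h - b) = h).
  { replace (b + h - b)%C with (RtoC h) by ring. rewrite Cmod_R. apply Rabs_pos_eq. lra. }
  destruct (open_mapping f b (b + h)%C (B - Cmod (b - a))) with (eps := eps)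
    as [d [Hd H]]; try assumption.
  - intros z Hz. exists (df z). auto.
  - rewrite Hz0. unfold h. lra.
  - intros E. apply f_inj in E; [| apply Hin; rewrite Hz0; unfold h; lra | exact Hb].
    rewrite E, Cmod_sub_self in Hz0. lra.
  - exists d. split; [exact Hd |]. intros w Hw. destruct (H w Hw) as [z [H1 [H2 H3]]].
    exists z. auto.
Qed.

Lemma local_inverse_ccont (b : C) : Cmod (b - a) < B -> ccont local_inverse (f b).
Proof.
  intros Hb eps Heps. destruct (injective_open b Hb eps Heps) as [d [Hd H]].
  exists d. split; [exact Hd |]. intros w Hw.
  destruct (H w Hw) as [z [Hz1 [Hz2 <-]]]. rewrite !local_inverse_spec; assumption.
Qed.

(** The slope of the inverse is the reciprocal of the slope of [f], which is nonzero off [b] by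
    injectivity and at [b] by hypothesis. *)
Lemma local_inverse_cderiv (b : C) : Cmod (b - a) < B -> df b <> 0%C ->
  cdiff local_inverse (f b).
Proof.
  intros Hb Hdf. set (q := fun w => (/ slope f b (df b) (local_inverse w))%C).
  exists (q (f b)). destruct (injective_open b Hb 1 Rlt_0_1) as [d [Hd H]].
  apply (cderiv_intro _ q (f b) d Hd).
  - intros w Hw. destruct (H w Hw) as [z [_ [Hz <-]]].
    unfold q. rewrite !local_inverse_spec by assumption.
    rewrite (slope_eq f b (df b) z) at 1. field.
    destruct (Ceq_dec z b) as [-> | Hzb]; [rewrite slope_at; exact Hdf |].
    intros E. apply Hzb, f_inj; try assumption.
    rewrite (slope_eq f b (df b) z), E. ring.
  - apply ccont_inv.
    + apply (ccont_comp (slope f b (df b)) local_inverse); [apply local_inverse_ccont, Hb |].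
      rewrite local_inverse_spec by exact Hb. apply f_deriv, Hb.
    + rewrite local_inverse_spec, slope_at by exact Hb. exact Hdf.
Qed.

(* The zeros of [df] are isolated, so a zero at [b] gives an isolated, hence
   removable, singularity of the continuous inverse at [f b]; the chain rule for
   [local_inverse (f z) = z] then contradicts [df b = 0]. *)
Lemma injective_deriv_neq_0 (b : C) : Cmod (b - a) < B -> df b <> 0%C.
Proof.
  intros Hb Hdf0.
  assert (Hin : forall z, Cmod (z - b) < B - Cmod (b - a) -> Cmod (z - a) < B).
  { intros z Hz. pose proof (Cmod_triangle_sub z b a). lra. }
  (* Otherwise [f] would be constant along a segment: with [c] the conjugate of the increment, the
     mean value theorem says that the squared modulus of the increment is 0. *)
  assert (Hz0 : exists z0, Cmod (z0 - b) < B - Cmod (b - a) /\ df z0 <> 0%C).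
  { apply NNPP. intros Hno.
    assert (Hdf : forall z, Cmod (z - b) < B - Cmod (b - a) -> df z = 0%C).
    { intros z Hz. apply NNPP. intros H. apply Hno. exists z. auto. }
    set (h := (B - Cmod (b - a)) / 2). assert (Hh : 0 < h) by (unfold h; lra).
    assert (Hseg : forall t, 0 <= t <= 1 -> Cmod (b + t * h - b) < B - Cmod (b - a)).
    { intros t Ht. replace (b + t * h - b)%C with (RtoC (t * h)) by (rewrite RtoC_mult; ring).
      rewrite Cmod_R, Rabs_pos_eq by nra. unfold h in *. nra. }
    destruct (mean_value_theorem_Re f df (Cconj (f (b + h)%C - f b)) b h) as [t [Ht E]].
    { intros t Ht. apply f_deriv, Hin, Hseg, Ht. }
    rewrite Hdf in E by (apply Hseg; lra).
    rewrite Cmult_comm, <- Cmod2_conj, re_RtoC in E.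
    replace (Cconj (f (b + h)%C - f b) * 0 * h)%C with (RtoC 0) in E by ring.
    rewrite re_RtoC in E.
    assert (E1 : (f (b + h)%C - f b)%C = 0%C).
    { apply Cmod_eq_0. pose proof (Cmod_ge_0 (f (b + h)%C - f b)). nra. }
    assert (E2 : (b + h)%C = b).
    { apply f_inj; [| exact Hb |].
      - apply Hin. specialize (Hseg 1 ltac:(lra)).
        replace (b + 1 * h)%C with (b + h)%C in Hseg by ring. exact Hseg.
      - replace (f (b + h)%C) with ((f (b + h)%C - f b) + f b)%C by ring.
        rewrite E1. ring. }
    assert (E3 : RtoC h = 0%C) by (replace (RtoC h) with (b + h - b)%C by ring; rewrite E2; ring).
    apply RtoC_inj in E3. lra. }
  destruct Hz0 as [z0 [Hz0 Hne]].
  destruct (order_lower_bound df b z0 (B - Cmod (b - a))) as [k [c [d [Hc [Hd Hlow]]]]];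
    [| exact Hz0 | exact Hne |].
  { intros z Hz. apply (cderiv_cdiff f df z (B - Cmod (z - a))).
    - specialize (Hin z Hz). lra.
    - intros w Hw. apply f_deriv. pose proof (Cmod_triangle_sub w z a). lra. }
  destruct (injective_open b Hb d Hd) as [e [He Himg]].
  destruct (removable_singularity local_inverse (f b) e He) as [m Hm].
  - intros w Hw. destruct (Himg w Hw) as [z [_ [Hz <-]]]. apply local_inverse_ccont, Hz.
  - intros w Hw. destruct (Himg w ltac:(lra)) as [z [Hzd [Hz Ew]]].
    assert (Hzb : z <> b) by (intros ->; rewrite Ew, Cmod_sub_self in Hw; lra).
    rewrite <- Ew. apply local_inverse_cderiv; [exact Hz |].
    apply Cmod_gt_0. eapply Rlt_le_trans; [| apply Hlow, Hzd].
    apply Rmult_lt_0_compat; [exact Hc | apply pow_lt, Cmod_sub_gt_0, Hzb].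
  - pose proof (cderiv_comp _ f b _ _ Hm (f_deriv b Hb)) as Hcomp.
    apply (cderiv_ext_loc _ (fun z => z) b _ (B - Cmod (b - a))) in Hcomp.
    + pose proof (cderiv_unique _ _ _ _ Hcomp (cderiv_id b)) as E.
      rewrite Hdf0, Cmult_0_r in E. apply RtoC_inj in E. lra.
    + lra.
    + intros z Hz. apply local_inverse_spec, Hin, Hz.
Qed.

Lemma local_inverse_cdiff (b : C) : Cmod (b - a) < B -> cdiff local_inverse (f b).
Proof. intros Hb. apply local_inverse_cderiv; [| apply injective_deriv_neq_0]; exact Hb. Qed.

End InjectiveHolomorphic.

(** [df] is continuous, so [df - df a] is smaller than [df a] on a small disk, which is convex.
    Between points with equal values the mean value theorem, tested against [df a * v], would make 0
    the sum of [Cmod (df a * v) ^ 2] and a strictly smaller error. *)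
Lemma cderiv_locally_injective (f df : C -> C) (a : C) (B : R) : 0 < B ->
  (forall z, Cmod (z - a) < B -> cderiv f z (df z)) -> df a <> 0%C ->
  exists delta, 0 < delta /\ forall z w, Cmod (z - a) < delta -> Cmod (w - a) < delta ->
    f z = f w -> z = w.
Proof.
  intros HB Hf Hdf.
  destruct (cdiff_ccont df a (cderiv_cdiff f df a B HB Hf) (Cmod (df a))) as [d [Hd Hc]].
  { apply Cmod_gt_0, Hdf. }
  exists (Rmin d B). split; [apply Rmin_pos; assumption |].
  pose proof (Rmin_l d B). pose proof (Rmin_r d B).
  intros z w Hz Hw E. apply NNPP. intros Hne.
  set (v := (z - w)%C). assert (Hv : 0 < Cmod v) by (apply Cmod_sub_gt_0, Hne).
  assert (Hseg : forall t : R, 0 <= t <= 1 -> Cmod (w + t * v - a) < Rmin d B).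
  { intros t Ht. replace (w + t * v - a)%C with ((1 - t)%R * (w - a) + t * (z - a))%C
      by (unfold v; rewrite RtoC_minus; ring).
    eapply Rle_lt_trans; [apply Cmod_triangle |].
    rewrite !Cmod_mult, !Cmod_R, !Rabs_pos_eq by lra.
    destruct (Req_dec t 0) as [-> | Ht0]; [nra |].
    assert (t * Cmod (z - a) < t * Rmin d B) by (apply Rmult_lt_compat_l; lra).
    assert ((1 - t) * Cmod (w - a) <= (1 - t) * Rmin d B) by (apply Rmult_le_compat_l; lra).
    lra. }
  destruct (mean_value_theorem_Re f df (Cconj (df a * v)) w v) as [t [Ht Eq]].
  { intros t Ht. apply Hf. specialize (Hseg t Ht). lra. }
  replace (w + v)%C with z in Eq by (unfold v; ring).
  rewrite E in Eq. replace (f w - f w)%C with (RtoC 0) in Eq by ring.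
  rewrite Cmult_0_r, re_RtoC in Eq.
  specialize (Hc (w + t * v)%C ltac:(specialize (Hseg t ltac:(lra)); lra)).
  set (x := df (w + t * v)%C) in *.
  replace (Cconj (df a * v) * x * v)%C
    with ((df a * v) * Cconj (df a * v) + Cconj (df a * v) * (x - df a) * v)%C in Eq by ring.
  rewrite <- Cmod2_conj in Eq.
  change (0 = Cmod (df a * v) ^ 2 + Re (Cconj (df a * v) * (x - df a) * v)) in Eq.
  pose proof (re_le_Cmod (Cconj (df a * v) * (x - df a) * v)) as Hre.
  rewrite !Cmod_mult, Cmod_conj, Cmod_mult in Hre. rewrite Cmod_mult in Eq.
  apply Rabs_le_between in Hre.
  apply Cmod_gt_0 in Hdf.
  assert (Cmod (df a) * Cmod v * Cmod (x - df a) * Cmod v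
    < Cmod (df a) * Cmod v * Cmod (df a) * Cmod v).
  { apply Rmult_lt_compat_r; [exact Hv |]. apply Rmult_lt_compat_l; [| exact Hc].
    apply Rmult_lt_0_compat; assumption. }
  rewrite <- Rsqr_pow2 in Eq. unfold Rsqr in Eq. lra.
Qed.

(** * Compactness and continuation *)

(** Compactness without sequences: [A e z] will say that [z] solves an equation whose parameter is
    within [e] of its limit. *)
Lemma disk_cluster_point (A : R -> C -> Prop) (rho : R) :
  (forall e e' z, e <= e' -> A e z -> A e' z) ->
  (forall e, 0 < e -> exists z, Cmod z <= rho /\ A e z) ->
  exists l, Cmod l <= rho /\
    forall e, 0 < e -> exists z, Cmod z <= rho /\ Cmod (z - l) < e /\ A e z.
Proof.
  intros Hmono Hne. apply NNPP. intros Hno.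
  (* The radius is [2 * d] because two coordinate distances below [d] add up to less than that. The
     compactness theorem covers a square, so points outside the disk need a radius as well. *)
  assert (H : forall u v : R, exists d : posreal,
    forall z, Cmod z <= rho -> Cmod (z - (u, v)) < 2 * d -> ~ A d z).
  { intros u v. destruct (Rle_or_lt (Cmod (u, v)) rho) as [Hl | Hl].
    - apply NNPP. intros Hd. apply Hno. exists (u, v). split; [exact Hl |].
      intros e He. assert (He2 : 0 < e / 2) by lra.
      apply NNPP. intros Hz. apply Hd. exists (mkposreal _ He2). simpl.
      intros z Hz1 Hz2 HA. apply Hz. exists z. repeat split; [exact Hz1 | lra |].
      apply (Hmono (e / 2)); [lra | exact HA].
    - assert (Hd : 0 < (Cmod (u, v) - rho) / 2) by lra.
      exists (mkposreal _ Hd). simpl. intros z Hz1 Hz2 _.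
      pose proof (Cmod_triangle_inv (u, v) z) as H. rewrite Cmod_sub_sym in H. lra. }
  set (delta := fun u v => proj1_sig (constructive_indefinite_description _ (H u v))).
  assert (Hdelta : forall u v z, Cmod z <= rho -> Cmod (z - (u, v)) < 2 * delta u v ->
    ~ A (delta u v) z).
  { intros u v. exact (proj2_sig (constructive_indefinite_description _ (H u v))). }
  destruct (compactness_value_2d (- rho) rho (- rho) rho delta) as [d Hd].
  destruct (Hne d (cond_pos d)) as [z [Hz HA]].
  pose proof (re_le_Cmod z) as H1. pose proof (im_le_Cmod z) as H2.
  apply Rabs_le_between in H1. apply Rabs_le_between in H2.
  apply (Hd (Re z) (Im z)); [lra | lra |].
  intros [u [v [_ [_ [Hu [Hv Hduv]]]]]].
  apply (Hdelta u v z Hz).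
  - eapply Rle_lt_trans; [apply Cmod_le_Rabs |].
    change (Rabs (Re z - u) + Rabs (Im z - v) < 2 * delta u v). lra.
  - apply (Hmono d); assumption.
Qed.

(** Let [m] be the infimum of the points down to which [P] holds throughout from 1. The limit
    hypothesis gives [P m], and the step hypothesis would go below [m] if it were positive. *)
Lemma backward_induction (P : R -> Prop) : P 1 ->
  (forall m, 0 <= m <= 1 ->
    (forall e, 0 < e -> exists s, m <= s < m + e /\ s <= 1 /\ P s) -> P m) ->
  (forall m, 0 < m <= 1 -> P m ->
    exists delta, 0 < delta /\ forall s, 0 <= s -> m - delta < s < m -> P s) ->
  forall t, 0 <= t <= 1 -> P t.
Proof.
  intros H1 Hclosed Hopen.
  (* [completeness] provides suprema, so the infimum is taken with the sign reversed. *)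
  set (E := fun x => 0 <= - x <= 1 /\ forall s, - x <= s <= 1 -> P s).
  destruct (completeness E) as [x [Hub Hlub]].
  - exists 0. intros x [Hx _]. lra.
  - exists (-1). split; [lra |]. intros s Hs. replace s with 1 by lra. exact H1.
  - set (m := - x).
    assert (Hm : 0 <= m <= 1).
    { split.
      - assert (x <= 0) by (apply Hlub; intros y [Hy _]; lra). unfold m. lra.
      - assert (-1 <= x); [| unfold m; lra]. apply Hub. split; [lra |].
        intros s Hs. replace s with 1 by lra. exact H1. }
    assert (Happ : forall e, 0 < e -> exists y, E y /\ - y < m + e).
    { intros e He. apply NNPP. intros Hno.
      assert (x <= x - e); [| lra]. apply Hlub. intros y Hy.
      apply Rnot_lt_le. intros Hlt. apply Hno. exists y. split; [exact Hy | unfold m; lra]. }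
    assert (Habove : forall s, m < s <= 1 -> P s).
    { intros s Hs. destruct (Happ (s - m)) as [y [[_ Hy] Hlt]]; [lra |]. apply Hy. lra. }
    assert (HPm : P m).
    { destruct (Req_dec m 1) as [-> | Hm1]; [exact H1 |].
      apply Hclosed; [exact Hm |]. intros e He. exists (Rmin 1 (m + e / 2)).
      pose proof (Rmin_l 1 (m + e / 2)). pose proof (Rmin_r 1 (m + e / 2)).
      assert (m < Rmin 1 (m + e / 2)) by (apply Rmin_glb_lt; lra).
      repeat split; try lra. apply Habove. lra. }
    assert (Hall : forall s, m <= s <= 1 -> P s).
    { intros s Hs. destruct (Req_dec s m) as [-> | Hsm]; [exact HPm | apply Habove; lra]. }
    destruct (Req_dec m 0) as [Hm0 | Hm0].
    + intros t Ht. apply Hall. lra.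
    + exfalso. destruct (Hopen m) as [d [Hd Hs]]; [lra | exact HPm |].
      assert (HE : E (- Rmax 0 (m - d / 2))).
      { pose proof (Rmax_l 0 (m - d / 2)). pose proof (Rmax_r 0 (m - d / 2)).
        assert (Rmax 0 (m - d / 2) < m) by (apply Rmax_lub_lt; lra).
        split; rewrite Ropp_involutive; [lra |]. intros s Hs'.
        destruct (Rlt_or_le s m) as [Hlt | Hle]; [apply Hs; lra | apply Hall; lra]. }
      apply Hub in HE.
      assert (Rmax 0 (m - d / 2) < m) by (apply Rmax_lub_lt; lra). unfold m in *. lra.
Qed.

Lemma Re_pos_of_nonneg (p : C -> C) : (forall z, Cmod z < 1 -> cdiff p z) -> p 0%C = 1%C ->
  (forall z, Cmod z < 1 -> 0 <= Re (p z)) -> forall z, Cmod z < 1 -> 0 < Re (p z).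
Proof.
  intros Hp Hp0 Hre.
  (* Used in both directions: [0 <= Re] bounds the Cayley transform by 1, and a transform of modulus
     below 1 forces [0 < Re]. *)
  assert (Hcayley : forall w, Cmod (w - 1) ^ 2 = Cmod (w + 1) ^ 2 - 4 * Re w).
  { intros w. rewrite !Cmod2_alt. destruct w. simpl. ring. }
  assert (Hneq : forall z, Cmod z < 1 -> (p z + 1)%C <> 0%C).
  { intros z Hz E. apply (f_equal Re) in E. rewrite re_RtoC in E.
    change (Re (p z) + 1 = 0) in E. specialize (Hre z Hz). lra. }
  set (q := fun z => ((p z - 1) * / (p z + 1))%C).
  assert (Hq : forall z, Cmod z < 1 -> Cmod (q z) <= Cmod z).
  { apply schwarz_lemma.
    - intros z Hz. apply cdiff_mult; [apply cdiff_minus; [auto | apply cdiff_const] |].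
      apply cdiff_inv; [apply cdiff_plus; [auto | apply cdiff_const] | auto].
    - unfold q. rewrite Hp0. ring.
    - intros z Hz. unfold q. rewrite Cmod_mult, Cmod_inv by auto.
      pose proof (Hneq z Hz) as Hn. apply Cmod_gt_0 in Hn.
      apply Rmult_le_reg_r with (Cmod (p z + 1)); [exact Hn |].
      rewrite Rmult_assoc, Rinv_l, Rmult_1_r, Rmult_1_l by lra.
      specialize (Hcayley (p z)). specialize (Hre z Hz).
      pose proof (Cmod_ge_0 (p z - 1)). nra. }
  intros z Hz. specialize (Hq z Hz). unfold q in Hq.
  pose proof (Hneq z Hz) as Hn. rewrite Cmod_mult, Cmod_inv in Hq by exact Hn.
  apply Cmod_gt_0 in Hn.
  assert (Cmod (p z - 1) < Cmod (p z + 1)).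
  { apply Rmult_lt_reg_r with (/ Cmod (p z + 1)); [apply Rinv_0_lt_compat, Hn |].
    rewrite Rinv_r by lra. lra. }
  specialize (Hcayley (p z)). pose proof (Cmod_ge_0 (p z - 1)). nra.
Qed.

Lemma polar_form (z : C) : exists theta, 0 <= theta < 2 * PI /\ z = (Cmod z * cis theta)%C.
Proof.
  pose proof PI_RGT_0 as Hpi.
  destruct (Ceq_dec z 0) as [-> | Hz].
  { exists 0. split; [lra |]. rewrite Cmod_0. ring. }
  apply Cmod_gt_0 in Hz. pose proof (Cmod2_alt z) as H2.
  set (x := Re z / Cmod z). set (y := Im z / Cmod z).
  assert (Hxy : x ^ 2 + y ^ 2 = 1).
  { transitivity ((Re z ^ 2 + Im z ^ 2) / Cmod z ^ 2); [unfold x, y; field; lra |].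
    rewrite <- H2. field. lra. }
  assert (Hx : -1 <= x <= 1) by (pose proof (pow2_ge_0 y); nra).
  assert (Hsin : sin (acos x) = Rabs y).
  { rewrite sin_acos by exact Hx. rewrite <- sqrt_Rsqr_abs. f_equal. unfold Rsqr. nra. }
  assert (Hz' : forall theta, cos theta = x -> sin theta = y -> z = (Cmod z * cis theta)%C).
  { intros theta Hc Hs. transitivity (Cmod z * x, Cmod z * y).
    - rewrite (surjective_pairing z) at 1. unfold x, y. f_equal.
      + change (Re z = Cmod z * (Re z / Cmod z)). field. lra.
      + change (Im z = Cmod z * (Im z / Cmod z)). field. lra.
    - unfold cis. rewrite Hc, Hs. unfold RtoC, Cmult; simpl. f_equal; ring. }
  pose proof (acos_bound x) as Hb.
  destruct (Rle_or_lt 0 y) as [Hy | Hy].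
  - exists (acos x). split; [lra |]. apply Hz'; [apply cos_acos, Hx |].
    rewrite Hsin. apply Rabs_pos_eq, Hy.
  - exists (2 * PI - acos x).
    (* [acos] covers only the upper half circle; in the lower half [y <> 0] rules out the excluded
       angle [2 * PI]. *)
    assert (acos x <> 0).
    { intros E. rewrite E, sin_0 in Hsin. symmetry in Hsin.
      apply Rabs_eq_0 in Hsin. lra. }
    split; [lra |]. apply Hz'.
    + rewrite cos_minus, cos_2PI, sin_2PI, cos_acos by exact Hx. ring.
    + rewrite sin_minus, cos_2PI, sin_2PI, Hsin, Rabs_left by exact Hy. ring.
Qed.

(** * Starlike functions *)

(** For small [h > 0] the sign of [Re (Cconj z * w)] decides whether [z - h * w] is closer to 0 than
    [z]. *)
Lemma Cmod2_sub_scal (z w : C) (h : R) :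
  Cmod (z - h * w) ^ 2 = Cmod z ^ 2 - 2 * h * Re (Cconj z * w) + h ^ 2 * Cmod w ^ 2.
Proof. rewrite !Cmod2_alt. destruct z, w. simpl. ring. Qed.

(** [p] is a positive multiple of the conjugate of [q]. This transfers signs between the quotient at
    [z] and [Cconj z * (F z / dF z)], whose product is [Cmod z ^ 2]. *)
Lemma Re_mult_pos_real (p q : C) (x : R) : 0 < x -> (p * q)%C = RtoC x ->
  (0 <= Re q -> 0 <= Re p) /\ (0 < Re q -> 0 < Re p).
Proof.
  intros Hx E.
  assert (Hq : 0 < Cmod q ^ 2).
  { apply pow_lt, Cmod_gt_0. intros ->. rewrite Cmult_0_r in E. apply RtoC_inj in E. lra. }
  assert (E2 : Re p * Cmod q ^ 2 = x * Re q).
  { rewrite <- re_scal_r, Cmod2_conj, Cmult_assoc, E, re_scal_l, re_conj. reflexivity. }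
  split; intros H; nra.
Qed.

Section Starlike.

Variables (F dF : C -> C).

Hypothesis F_deriv : forall z, Cmod z < 1 -> cderiv F z (dF z).
Hypothesis F_0 : F 0%C = 0%C.
Hypothesis dF_0 : dF 0%C = 1%C.

Let F1 := slope F 0 1.

(* The value at [0] of the quotient is the limit value, since [F z = z * F1 z]. *)
Let p (z : C) : C := (dF z * / F1 z)%C.

Lemma Csub_0_r (z : C) : (z - 0)%C = z.
Proof. ring. Qed.

Lemma near_in_disk (a z : C) : Cmod (z - a) < 1 - Cmod a -> Cmod z < 1.
Proof.
  intros H. pose proof (Cmod_triangle_inv z a). lra.
Qed.

Lemma F_deriv_near (a : C) : Cmod a < 1 ->
  forall z, Cmod (z - a) < 1 - Cmod a -> cderiv F z (dF z).
Proof. intros Ha z Hz. apply F_deriv, (near_in_disk a), Hz. Qed.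

Lemma F_deriv_centered (z : C) : Cmod (z - 0) < 1 -> cderiv F z (dF z).
Proof. rewrite Csub_0_r. apply F_deriv. Qed.

Lemma F_ccont (z : C) : Cmod z < 1 -> ccont F z.
Proof. intros Hz. exact (cderiv_ccont F z _ (F_deriv z Hz)). Qed.

Lemma F_factor (z : C) : F z = (z * F1 z)%C.
Proof. rewrite (slope_eq F 0 1 z), F_0. fold F1. ring. Qed.

Lemma F1_0 : F1 0%C = 1%C.
Proof. apply slope_at. Qed.

Lemma F1_cdiff (z : C) : Cmod z < 1 -> cdiff F1 z.
Proof.
  intros Hz. apply (slope_cdiff F 0 1 1); [lra | | | rewrite Csub_0_r; exact Hz].
  - intros w Hw. exists (dF w). apply F_deriv_centered, Hw.
  - rewrite <- dF_0. apply F_deriv. rewrite Cmod_0. lra.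
Qed.

Lemma dF_cdiff (z : C) : Cmod z < 1 -> cdiff dF z.
Proof. intros Hz. apply (cderiv_cdiff F dF z (1 - Cmod z)); [lra | apply F_deriv_near, Hz]. Qed.

Definition nonvanishing : Prop := forall z, Cmod z < 1 -> z <> 0%C -> F z <> 0%C.

Lemma F1_neq_0 : nonvanishing -> forall z, Cmod z < 1 -> F1 z <> 0%C.
Proof.
  intros HF z Hz. destruct (Ceq_dec z 0) as [-> | H0].
  - rewrite F1_0. intros E. apply RtoC_inj in E. lra.
  - intros E. apply (HF z Hz H0). rewrite F_factor, E. ring.
Qed.

Lemma p_0 : p 0%C = 1%C.
Proof. unfold p. rewrite dF_0, F1_0. field. Qed.

Lemma p_Re_pos_of_nonneg : nonvanishing -> (forall z, Cmod z < 1 -> 0 <= Re (p z)) ->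
  forall z, Cmod z < 1 -> 0 < Re (p z).
Proof.
  intros HF Hp. apply Re_pos_of_nonneg; [| exact p_0 | exact Hp].
  intros z Hz. apply cdiff_mult; [apply dF_cdiff, Hz |].
  apply cdiff_inv; [apply F1_cdiff, Hz | apply F1_neq_0; assumption].
Qed.

(** * The modulus of F along a ray *)

Lemma derivable_Cmod2_ray (r theta : R) : Cmod (r * cis theta) < 1 ->
  derivable_pt_lim (fun s => Cmod (F (s * cis theta)%C) ^ 2) r
    (2 * Re (Cconj (F (r * cis theta)%C) * dF (r * cis theta)%C * cis theta)).
Proof.
  intros Hr. set (d := cis theta) in *.
  assert (Hray : forall s : R, (0 + s * d)%C = (s * d)%C) by (intros; ring).
  assert (HF : cderiv F (0 + r * d) (dF (r * d)%C)).
  { rewrite Hray. apply F_deriv, Hr. }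
  pose proof (derivable_pt_lim_line F 1 0 d _ r HF) as H1.
  pose proof (derivable_pt_lim_line F (- Ci) 0 d _ r HF) as H2.
  (* The squared modulus is the sum of the squares of [Re F] and of [Im F], the latter being the
     real part of [- Ci * F]. *)
  pose proof (derivable_pt_lim_plus _ _ _ _ _
    (derivable_pt_lim_mult _ _ _ _ _ H1 H1) (derivable_pt_lim_mult _ _ _ _ _ H2 H2)) as H.
  unfold plus_fct, mult_fct in H. rewrite Hray in H.
  match type of H with derivable_pt_lim _ _ ?k =>
    replace (2 * Re (Cconj (F (r * d)%C) * dF (r * d)%C * d)) with k end.
  - intros eps Heps. destruct (H eps Heps) as [e He]. exists e. intros h Hh0 Hh.
    specialize (He h Hh0 Hh). rewrite !Hray in He. rewrite !Cmod2_alt.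
    revert He. destruct (F ((r + h)%R * d)%C), (F (r * d)%C). simpl.
    match goal with |- Rabs ?X < _ -> Rabs ?Y < _ => replace Y with X; [tauto |] end.
    unfold Rdiv. f_equal. f_equal. ring.
  - destruct (F (r * d)%C), (dF (r * d)%C), d. simpl. ring.
Qed.

(** With [z = r * cis theta] both sides equal [Cconj (F z) * dF z * z], because [F z = z * F1 z]. *)
Lemma ray_derivative_eq (r theta : R) : 0 < r -> F1 (r * cis theta)%C <> 0%C ->
  (p (r * cis theta) * Cmod (F (r * cis theta)%C) ^ 2)%C =
  (r * (Cconj (F (r * cis theta)%C) * dF (r * cis theta)%C * cis theta))%C.
Proof.
  intros Hr H1. set (z := (r * cis theta)%C) in *.
  transitivity (p z * RtoC (Cmod (F z) ^ 2))%C.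
  { now rewrite RtoC_pow. }
  rewrite Cmod2_conj. generalize (Cconj (F z)). intros c. unfold p. rewrite (F_factor z).
  replace (r * (c * dF z * cis theta))%C with (c * dF z * z)%C by (unfold z; ring).
  field. exact H1.
Qed.

Lemma p_Re_ray (r theta : R) : 0 < r -> F1 (r * cis theta)%C <> 0%C ->
  Re (p (r * cis theta)%C) * Cmod (F (r * cis theta)%C) ^ 2 =
  r * Re (Cconj (F (r * cis theta)%C) * dF (r * cis theta)%C * cis theta).
Proof.
  intros Hr H1. pose proof (ray_derivative_eq r theta Hr H1) as E.
  rewrite <- RtoC_pow in E. apply (f_equal Re) in E.
  rewrite re_scal_r, re_scal_l in E. exact E.
Qed.

Lemma Cmod_ray (r theta : R) : 0 <= r -> Cmod (r * cis theta) = r.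
Proof. intros Hr. rewrite Cmod_mult, Cmod_cis, Cmod_R, Rabs_pos_eq by exact Hr. ring. Qed.

Lemma radially_increasing_of_Re_pos : nonvanishing ->
  (forall z, Cmod z < 1 -> 0 < Re (p z)) -> radially_increasing_modulus F.
Proof.
  intros HF Hp theta _ r s Hr Hrs Hs.
  (* The intermediate point is positive even when [r = 0], so the ray identity and the nonvanishing
     of [F] apply to it. *)
  destruct (MVT_cor2 (fun s => Cmod (F (s * cis theta)%C) ^ 2)
    (fun r => 2 * Re (Cconj (F (r * cis theta)%C) * dF (r * cis theta)%C * cis theta))
    r s Hrs) as [c [E Hc]].
  { intros c Hc. apply derivable_Cmod2_ray. rewrite Cmod_ray; lra. }
  assert (Hz : Cmod (c * cis theta) < 1) by (rewrite Cmod_ray; lra).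
  assert (Hz0 : (c * cis theta)%C <> 0%C) by (apply Cmod_gt_0; rewrite Cmod_ray; lra).
  pose proof (p_Re_ray c theta ltac:(lra) (F1_neq_0 HF _ Hz)) as Ep.
  specialize (Hp _ Hz).
  pose proof (HF _ Hz Hz0) as HFz. apply Cmod_gt_0 in HFz.
  assert (0 < Re (p (c * cis theta)%C) * Cmod (F (c * cis theta)%C) ^ 2).
  { apply Rmult_lt_0_compat; [exact Hp | apply pow_lt, HFz]. }
  set (D := Re (Cconj (F (c * cis theta)%C) * dF (c * cis theta)%C * cis theta)) in *.
  assert (0 < D) by nra.
  assert (0 < 2 * D * (s - r)) by (apply Rmult_lt_0_compat; lra).
  cbv beta in *.
  apply Rnot_le_lt. intros Hle.
  assert (Cmod (F (s * cis theta)%C) ^ 2 <= Cmod (F (r * cis theta)%C) ^ 2).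
  { apply pow_incr. split; [apply Cmod_ge_0 | exact Hle]. }
  lra.
Qed.

Lemma Re_pos_of_radially_increasing : radially_increasing_modulus F ->
  nonvanishing /\ (forall z, Cmod z < 1 -> 0 < Re (p z)).
Proof.
  intros HM.
  assert (HF : nonvanishing).
  { intros z Hz Hz0 E. destruct (polar_form z) as [theta [Ht Ez]].
    apply Cmod_gt_0 in Hz0.
    specialize (HM theta Ht 0 (Cmod z) (Rle_refl 0) Hz0 Hz). cbv beta in HM.
    rewrite <- Ez, E, Cmult_0_l, F_0 in HM. lra. }
  split; [exact HF |]. apply p_Re_pos_of_nonneg; [exact HF |].
  intros z Hz. destruct (Ceq_dec z 0) as [-> | Hz0].
  { rewrite p_0, re_RtoC. lra. }
  pose proof (HF z Hz Hz0) as HFz. apply Cmod_gt_0 in HFz.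
  destruct (polar_form z) as [theta [Ht Ez]]. apply Cmod_gt_0 in Hz0.
  set (r := Cmod z) in *.
  pose proof (p_Re_ray r theta Hz0) as Ep. rewrite <- Ez in Ep.
  specialize (Ep (F1_neq_0 HF z Hz)).
  pose proof (derivable_Cmod2_ray r theta) as Hd. rewrite <- Ez in Hd. specialize (Hd Hz).
  set (D := Re (Cconj (F z) * dF z * cis theta)) in *.
  (* Monotonicity passes to the derivative only as a non-strict inequality; strictness returns
     through [p_Re_pos_of_nonneg]. *)
  assert (HD : 0 <= D).
  { apply Rnot_lt_le. intros HD. destruct (Hd (- D)) as [e He]; [lra |].
    set (h := Rmin (e / 2) ((1 - r) / 2)). pose proof (cond_pos e) as Hep.
    assert (Hh : 0 < h) by (apply Rmin_pos; lra).
    assert (Hh1 : h <= e / 2) by apply Rmin_l. assert (Hh2 : h <= (1 - r) / 2) by apply Rmin_r.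
    specialize (He h). rewrite Rabs_pos_eq in He by lra. specialize (He ltac:(lra) ltac:(lra)).
    specialize (HM theta Ht r (r + h) ltac:(lra) ltac:(lra) ltac:(lra)). cbv beta in HM.
    apply Rabs_def2 in He. destruct He as [He _].
    assert (0 <= (Cmod (F ((r + h)%R * cis theta)%C) ^ 2 - Cmod (F (r * cis theta)%C) ^ 2) / h).
    { apply Rdiv_le_0_compat; [| exact Hh].
      assert (Cmod (F (r * cis theta)%C) ^ 2 <= Cmod (F ((r + h)%R * cis theta)%C) ^ 2); [| lra].
      apply pow_incr. split; [apply Cmod_ge_0 | lra]. }
    lra. }
  assert (0 < Cmod (F z) ^ 2) by (apply pow_lt, HFz). nra.
Qed.

(** * From starlikeness to a positive real part *)

Lemma p_mult_eq (z : C) : nonvanishing -> Cmod z < 1 -> z <> 0%C -> dF z <> 0%C ->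
  (p z * (Cconj z * (F z * / dF z)))%C = RtoC (Cmod z ^ 2).
Proof.
  intros HF Hz Hz0 Hd. rewrite Cmod2_conj. unfold p. rewrite (F_factor z).
  field. split; [exact Hd | apply F1_neq_0; assumption].
Qed.

(* The solutions [w] near [z] of [F w = t * F z] satisfy [w = z - (1 - t) * step z w],
   and [step z w] tends to [F z / dF z] as [w] tends to [z]. *)
Definition step (z w : C) : C := (F z * / slope F z (dF z) w)%C.

Lemma step_ccont (z : C) : Cmod z < 1 -> dF z <> 0%C -> ccont (step z) z.
Proof.
  intros Hz Hd. apply ccont_mult; [apply ccont_const |].
  apply ccont_inv; [apply F_deriv, Hz | rewrite slope_at; exact Hd].
Qed.

Lemma step_self (z : C) : step z z = (F z * / dF z)%C.
Proof. unfold step. rewrite slope_at. reflexivity. Qed.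

Lemma step_eq (z w : C) (t : R) : F z <> 0%C -> t <> 1 -> F w = (t * F z)%C ->
  w = (z - (1 - t)%R * step z w)%C.
Proof.
  intros HFz Ht E.
  assert (Ht' : RtoC (1 - t) <> 0%C) by (apply RtoC_neq; lra).
  assert (Es : ((w - z) * slope F z (dF z) w)%C = (- ((1 - t)%R * F z))%C).
  { rewrite (slope_eq F z (dF z) w) in E.
    replace ((w - z) * slope F z (dF z) w)%C
      with (F z + (w - z) * slope F z (dF z) w - F z)%C by ring.
    rewrite E, RtoC_minus. ring. }
  assert (Hs : slope F z (dF z) w <> 0%C).
  { intros H. rewrite H, Cmult_0_r in Es.
    apply (Cmult_neq_0 _ _ Ht' HFz).
    replace (RtoC (1 - t) * F z)%C with (- - (RtoC (1 - t) * F z))%C by ring.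
    rewrite <- Es. ring. }
  unfold step.
  replace (RtoC (1 - t) * (F z * / slope F z (dF z) w))%C
    with (- (- (RtoC (1 - t) * F z)) * / slope F z (dF z) w)%C by ring.
  rewrite <- Es. field. exact Hs.
Qed.

Lemma Re_step_near (z : C) (m : R) : Cmod z < 1 -> dF z <> 0%C ->
  0 < m -> exists eta, 0 < eta /\ forall w, Cmod (w - z) < eta ->
    Rabs (Re (Cconj z * step z w) - Re (Cconj z * step z z)) < m.
Proof.
  intros Hz Hd Hm. pose proof (Cmod_ge_0 z) as Hz0.
  destruct (step_ccont z Hz Hd (m / 2)) as [eta [He H]]; [lra |].
  exists eta. split; [exact He |]. intros w Hw. specialize (H w Hw).
  change (Rabs (Re (Cconj z * step z w - Cconj z * step z z)) < m).
  eapply Rle_lt_trans; [apply re_le_Cmod |].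
  replace (Cconj z * step z w - Cconj z * step z z)%C
    with (Cconj z * (step z w - step z z))%C by ring.
  rewrite Cmod_mult, Cmod_conj. pose proof (Cmod_ge_0 (step z w - step z z)). nra.
Qed.

Lemma Re_pos_of_starlike : starlike_wrt_0 F ->
  nonvanishing /\ (forall z, Cmod z < 1 -> 0 < Re (p z)).
Proof.
  intros [Hinj Hstar].
  assert (Hinj0 : forall z w, Cmod (z - 0) < 1 -> Cmod (w - 0) < 1 -> F z = F w -> z = w).
  { intros z w. rewrite !Csub_0_r. apply Hinj. }
  assert (H0 : Cmod 0 < 1) by (rewrite Cmod_0; lra).
  assert (HF : nonvanishing).
  { intros z Hz Hz0 E. apply Hz0, Hinj; [exact Hz | exact H0 | now rewrite F_0]. }
  assert (HdF : forall z, Cmod z < 1 -> dF z <> 0%C).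
  { intros z Hz. apply (injective_deriv_neq_0 F dF 0 1 F_deriv_centered Hinj0).
    rewrite Csub_0_r. exact Hz. }
  set (H := local_inverse F 0 1).
  assert (HH : forall z, Cmod z < 1 -> H (F z) = z).
  { intros z Hz. apply local_inverse_spec; [exact Hinj0 | rewrite Csub_0_r; exact Hz]. }
  assert (Hstar' : forall t z, 0 <= t <= 1 -> Cmod z < 1 ->
    exists w, Cmod w < 1 /\ F w = (t * F z)%C).
  { intros t z Ht Hz. apply (Hstar t Ht). exists z. auto. }
  (* The Schwarz lemma is applied to [H (t * F z)]. By starlikeness [t * F z] is again a value of
     [F], so [H] is differentiable there and takes its value in the disk. *)
  assert (Hschwarz : forall t z w, 0 <= t <= 1 -> Cmod z < 1 -> Cmod w < 1 ->
    F w = (t * F z)%C -> Cmod w <= Cmod z).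
  { intros t z w Ht Hz Hw E. rewrite <- (HH w Hw), E.
    apply (schwarz_lemma (fun z => H (t * F z)%C)); [| | | exact Hz].
    - intros u Hu. apply (cdiff_comp H (fun z => (t * F z)%C)).
      + destruct (Hstar' t u Ht Hu) as [v [Hv <-]].
        apply (local_inverse_cdiff F dF 0 1 F_deriv_centered Hinj0).
        rewrite Csub_0_r. exact Hv.
      + apply cdiff_mult; [apply cdiff_const | exists (dF u); apply F_deriv, Hu].
    - rewrite F_0, Cmult_0_r. transitivity (H (F 0%C)); [now rewrite F_0 | apply HH, H0].
    - intros u Hu. destruct (Hstar' t u Ht Hu) as [v [Hv <-]]. rewrite HH by exact Hv. lra. }
  split; [exact HF |]. apply p_Re_pos_of_nonneg; [exact HF |].
  intros z Hz. destruct (Ceq_dec z 0) as [-> | Hz0].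
  { rewrite p_0, re_RtoC. lra. }
  apply (Re_mult_pos_real (p z) (Cconj z * step z z)%C (Cmod z ^ 2)).
  { apply pow_lt, Cmod_gt_0, Hz0. }
  { rewrite step_self. apply p_mult_eq; auto. }
  (* If the real part were negative, it would stay so near [z], and the solution
     [w = z - h * step z w] would have larger modulus than [z]. *)
  apply Rnot_lt_le. intros Hneg.
  destruct (Re_step_near z (- Re (Cconj z * step z z)) Hz (HdF z Hz)) as [eta [He Hstep]];
    [lra |].
  destruct (local_inverse_ccont F dF 0 1 F_deriv_centered Hinj0 z) with (eps := eta)
    as [d [Hd HHc]]; [rewrite Csub_0_r; exact Hz | exact He |].
  fold H in HHc. rewrite HH in HHc by exact Hz.
  pose proof (Cmod_ge_0 (F z)) as HFp.
  (* Chosen so that [h * Cmod (F z) < d]: then [(1 - h) * F z] is close enough to [F z] for its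
     preimage to be within [eta] of [z]. *)
  set (h := Rmin 1 (d / (Cmod (F z) + 1)) / 2).
  assert (Hmin : 0 < Rmin 1 (d / (Cmod (F z) + 1)))
    by (apply Rmin_pos; [lra | apply Rdiv_lt_0_compat; lra]).
  pose proof (Rmin_l 1 (d / (Cmod (F z) + 1))). pose proof (Rmin_r 1 (d / (Cmod (F z) + 1))).
  assert (Hh : 0 < h < 1) by (unfold h; lra).
  destruct (Hstar' (1 - h) z ltac:(lra) Hz) as [w [Hw E]].
  assert (Hwz : Cmod (w - z) < eta).
  { rewrite <- (HH w Hw). apply HHc. rewrite E, RtoC_minus.
    replace ((1 - h) * F z - F z)%C with (- (h * F z))%C by ring.
    rewrite Cmod_opp, Cmod_mult, Cmod_R, Rabs_pos_eq by lra.
    apply Rle_lt_trans with (h * (Cmod (F z) + 1)); [apply Rmult_le_compat_l; lra |].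
    apply Rmult_lt_reg_r with (/ (Cmod (F z) + 1)); [apply Rinv_0_lt_compat; lra |].
    rewrite Rmult_assoc, Rinv_r by lra. unfold h, Rdiv in *. lra. }
  pose proof (Hschwarz (1 - h) z w ltac:(lra) Hz Hw E) as Hle.
  specialize (Hstep w Hwz). apply Rabs_def2 in Hstep.
  assert (Ew : w = (z - h * step z w)%C).
  { rewrite (step_eq z w (1 - h)) at 1; [| apply HF; assumption | lra | exact E].
    replace (1 - (1 - h)) with h by ring. reflexivity. }
  assert (Hsq : Cmod w ^ 2 <= Cmod z ^ 2) by (apply pow_incr; split; [apply Cmod_ge_0 | exact Hle]).
  rewrite Ew, Cmod2_sub_scal in Hsq.
  pose proof (pow2_ge_0 h). pose proof (pow2_ge_0 (Cmod (step z w))).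
  assert (0 <= h ^ 2 * Cmod (step z w) ^ 2) by (apply Rmult_le_pos; assumption).
  assert (0 < h * - Re (Cconj z * step z w)) by (apply Rmult_lt_0_compat; lra).
  lra.
Qed.

(** * From a positive real part to starlikeness *)

Section RePos.

Hypothesis F_nonvanishing : nonvanishing.
Hypothesis p_Re_pos : forall z, Cmod z < 1 -> 0 < Re (p z).

Lemma dF_neq_0 (z : C) : Cmod z < 1 -> dF z <> 0%C.
Proof.
  intros Hz E. specialize (p_Re_pos z Hz). unfold p in p_Re_pos.
  rewrite E, Cmult_0_l, re_RtoC in p_Re_pos. lra.
Qed.

Lemma F_locally_injective (a : C) : Cmod a < 1 -> exists delta, 0 < delta /\
  forall z w, Cmod (z - a) < delta -> Cmod (w - a) < delta -> F z = F w -> z = w.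
Proof.
  intros Ha. apply (cderiv_locally_injective F dF a (1 - Cmod a)); [lra | | apply dF_neq_0, Ha].
  apply F_deriv_near, Ha.
Qed.

Lemma F_open (a : C) : Cmod a < 1 -> forall eps, 0 < eps ->
  exists delta, 0 < delta /\ forall w, Cmod (w - F a) < delta ->
    exists z, Cmod (z - a) < eps /\ F z = w.
Proof.
  intros Ha eps Heps. destruct (F_locally_injective a Ha) as [d [Hd Hinj]].
  set (B := Rmin d (1 - Cmod a)). assert (HB : 0 < B) by (apply Rmin_pos; lra).
  assert (HB1 : B <= d) by apply Rmin_l. assert (HB2 : B <= 1 - Cmod a) by apply Rmin_r.
  destruct (injective_open F dF a B) with (b := a) (eps := eps) as [e [He H]].
  - intros z Hz. apply (F_deriv_near a Ha). lra.
  - intros z w Hz Hw. apply Hinj; lra.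
  - rewrite Cmod_sub_self. exact HB.
  - exact Heps.
  - exists e. split; [exact He |]. intros w Hw. destruct (H w Hw) as [z [H1 [_ H3]]].
    exists z. auto.
Qed.

Lemma shrink_preimage (z : C) : Cmod z < 1 -> z <> 0%C -> forall eps, 0 < eps ->
  exists delta, 0 < delta /\ forall t : R, 1 - delta < t < 1 ->
    exists w, Cmod (w - z) < eps /\ Cmod w < Cmod z /\ F w = (t * F z)%C.
Proof.
  intros Hz Hz0 eps Heps. pose proof (dF_neq_0 z Hz) as Hd.
  pose proof (F_nonvanishing z Hz Hz0) as HFz.
  (* Half of the value at [z], so that [Re (Cconj z * step z w)] stays above [m] for [w] near
     [z]. *)
  set (m := Re (Cconj z * step z z) / 2).
  assert (Hm : 0 < m).
  { assert (0 < Re (Cconj z * step z z)); [| unfold m; lra].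
    apply (Re_mult_pos_real (Cconj z * step z z)%C (p z) (Cmod z ^ 2)).
    - apply pow_lt, Cmod_gt_0, Hz0.
    - rewrite Cmult_comm, step_self. apply p_mult_eq; assumption.
    - apply p_Re_pos, Hz. }
  destruct (Re_step_near z m Hz Hd Hm) as [e1 [He1 Hstep]].
  destruct (step_ccont z Hz Hd 1 Rlt_0_1) as [e2 [He2 Hbound]].
  set (K := Cmod (step z z) + 1). pose proof (Cmod_ge_0 (step z z)) as HK0.
  assert (HK : 0 < K) by (unfold K; lra).
  destruct (F_open z Hz (Rmin eps (Rmin e1 e2))) as [e3 [He3 Hopen]].
  { repeat apply Rmin_pos; assumption. }
  pose proof (Rmin_l eps (Rmin e1 e2)). pose proof (Rmin_r eps (Rmin e1 e2)).
  pose proof (Rmin_l e1 e2). pose proof (Rmin_r e1 e2).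
  apply Cmod_gt_0 in HFz as HFp.
  (* [d1] brings [t * F z] into the neighbourhood reached by [F_open]; [d2] makes
     [h * Cmod (step z w) ^ 2] smaller than [m], so the linear term of [Cmod2_sub_scal] wins. *)
  set (d1 := e3 / Cmod (F z)). set (d2 := m / K ^ 2).
  assert (Hd1 : 0 < d1) by (apply Rdiv_lt_0_compat; assumption).
  assert (HK2 : 0 < K ^ 2) by (apply pow_lt; exact HK).
  assert (Hd2 : 0 < d2) by (apply Rdiv_lt_0_compat; assumption).
  exists (Rmin d1 d2). split; [apply Rmin_pos; assumption |].
  intros t Ht. pose proof (Rmin_l d1 d2). pose proof (Rmin_r d1 d2).
  set (h := 1 - t). assert (Hh : 0 < h /\ h < d1 /\ h < d2) by (unfold h; lra).
  destruct Hh as [Hh0 [Hh1 Hh2]].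
  destruct (Hopen (t * F z)%C) as [w [Hw E]].
  { replace (t * F z - F z)%C with (- (h * F z))%C by (unfold h; rewrite RtoC_minus; ring).
    rewrite Cmod_opp, Cmod_mult, Cmod_R, Rabs_pos_eq by lra.
    apply Rmult_lt_compat_r with (r := Cmod (F z)) in Hh1; [| exact HFp].
    replace (d1 * Cmod (F z)) with e3 in Hh1 by (unfold d1; field; lra). exact Hh1. }
  exists w. repeat split; [lra | | exact E].
  specialize (Hstep w ltac:(lra)). specialize (Hbound w ltac:(lra)).
  apply Rabs_def2 in Hstep.
  assert (Hre : m < Re (Cconj z * step z w)) by (unfold m in *; lra).
  assert (HKw : Cmod (step z w) < K).
  { pose proof (Cmod_triangle_inv (step z w) (step z z)). unfold K. lra. }
  assert (Ew : w = (z - h * step z w)%C).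
  { apply step_eq; [exact HFz | lra | exact E]. }
  apply Rnot_le_lt. intros Hle.
  assert (Hsq : Cmod z ^ 2 <= Cmod w ^ 2) by (apply pow_incr; split; [apply Cmod_ge_0 | exact Hle]).
  rewrite Ew, Cmod2_sub_scal in Hsq.
  assert (Hhk : h * K ^ 2 < m).
  { apply Rmult_lt_compat_r with (r := K ^ 2) in Hh2; [| exact HK2].
    replace (d2 * K ^ 2) with m in Hh2 by (unfold d2; field; lra). exact Hh2. }
  assert (Hk2 : Cmod (step z w) ^ 2 <= K ^ 2).
  { apply pow_incr. split; [apply Cmod_ge_0 | lra]. }
  assert (h * Cmod (step z w) ^ 2 <= h * K ^ 2) by (apply Rmult_le_compat_l; lra).
  assert (h * (h * Cmod (step z w) ^ 2) < h * (2 * Re (Cconj z * step z w)))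
    by (apply Rmult_lt_compat_l; lra).
  replace (h ^ 2 * Cmod (step z w) ^ 2) with (h * (h * Cmod (step z w) ^ 2)) in Hsq by ring.
  lra.
Qed.

(** Continuity of [F] in the form that the limit steps of both continuations use. *)
Lemma F_limit_value (l v : C) (m : R) : Cmod l < 1 ->
  (forall e, 0 < e -> exists z s, Cmod (z - l) < e /\ m <= s < m + e /\ F z = (s * v)%C) ->
  F l = (m * v)%C.
Proof.
  intros Hl Happ. pose proof (Cmod_ge_0 v) as Hv.
  replace (F l) with ((F l - m * v) + m * v)%C by ring.
  rewrite (Cmod_small_eq_0 (F l - m * v)); [ring |]. intros eps Heps.
  destruct (F_ccont l Hl (eps / 2)) as [d [Hd Hc]]; [lra |].
  set (e := Rmin d (eps / (2 * (Cmod v + 1)))).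
  assert (He1 : e <= d) by apply Rmin_l.
  assert (He2 : e <= eps / (2 * (Cmod v + 1))) by apply Rmin_r.
  destruct (Happ e) as [z [s [Hz [Hs E]]]].
  { apply Rmin_pos; [exact Hd | apply Rdiv_lt_0_compat; lra]. }
  specialize (Hc z ltac:(lra)).
  pose proof (Cmod_triangle_sub (F l) (F z) (m * v)) as H1.
  rewrite (Cmod_sub_sym (F l) (F z)) in H1.
  assert (H2 : Cmod (F z - m * v) <= eps / 2).
  { rewrite E. replace (s * v - m * v)%C with ((s - m)%R * v)%C by (rewrite RtoC_minus; ring).
    rewrite Cmod_mult, Cmod_R, Rabs_pos_eq by lra.
    apply Rle_trans with (eps / (2 * (Cmod v + 1)) * (Cmod v + 1)).
    - apply Rmult_le_compat; lra.
    - right. field. lra. }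
  lra.
Qed.

Lemma preimage_of_shrunk_value (z : C) (t : R) : Cmod z < 1 -> 0 <= t <= 1 ->
  exists w, Cmod w <= Cmod z /\ F w = (t * F z)%C.
Proof.
  intros Hz Ht. destruct (Ceq_dec z 0) as [-> | Hz0].
  { exists 0%C. split; [lra |]. rewrite F_0. ring. }
  pose proof (F_nonvanishing z Hz Hz0) as HFz.
  revert t Ht. apply backward_induction.
  - exists z. split; [lra | ring].
  - intros m Hm Happ.
    (* The bound by [Cmod z < 1] keeps the approximate solutions in a compact part of the domain, so
       a cluster point exists where [F] is continuous. *)
    destruct (disk_cluster_point
      (fun e w => exists s, m <= s < m + e /\ F w = (s * F z)%C) (Cmod z)) as [l [Hl Hcl]].
    { intros e e' w Hee [s [Hs E]]. exists s. split; [lra | exact E]. }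
    { intros e He. destruct (Happ e He) as [s [Hs [_ [w [Hw E]]]]].
      exists w. split; [exact Hw |]. exists s. auto. }
    exists l. split; [exact Hl |]. apply F_limit_value; [lra |].
    intros e He. destruct (Hcl e He) as [w [_ [Hw [s [Hs E]]]]]. exists w, s. auto.
  - intros m Hm [w [Hw E]].
    assert (Hw0 : w <> 0%C).
    { intros ->. rewrite F_0 in E. symmetry in E. revert E.
      apply Cmult_neq_0; [apply RtoC_neq; lra | exact HFz]. }
    destruct (shrink_preimage w ltac:(lra) Hw0 1 Rlt_0_1) as [d [Hd H]].
    (* Since [s * F z = (s / m) * F w], the ratio to be reached from [w] is [s / m], and it exceeds
       [1 - d] exactly when [s > m - m * d]. *)
    exists (m * d). split; [apply Rmult_lt_0_compat; lra |]. intros s _ Hs.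
    destruct (H (s / m)) as [u [_ [Hu Eu]]].
    { split; apply Rmult_lt_reg_r with m; try lra; unfold Rdiv;
        rewrite Rmult_assoc, Rinv_l by lra; lra. }
    exists u. split; [lra |]. rewrite Eu, E.
    replace (RtoC s) with (RtoC (s / m) * RtoC m)%C; [ring |].
    rewrite <- RtoC_mult. f_equal. field. lra.
Qed.

(* Two distinct preimages of [F z1 = F z2] could be followed down to two distinct
   preimages of [0]: they can only merge at a point where [F] is not locally
   injective. *)
Lemma F_injective (z1 z2 : C) : Cmod z1 < 1 -> Cmod z2 < 1 -> F z1 = F z2 -> z1 = z2.
Proof.
  intros Hz1 Hz2 EF. apply NNPP. intros Hne.
  set (v := F z1).
  assert (Hv : v <> 0%C).
  { intros Hv. apply Hne.
    transitivity (RtoC 0); [| symmetry]; apply NNPP; intros H.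
    - exact (F_nonvanishing z1 Hz1 H Hv).
    - apply (F_nonvanishing z2 Hz2 H). rewrite <- EF. exact Hv. }
  set (rho := Rmax (Cmod z1) (Cmod z2)).
  assert (Hrho : rho < 1) by (apply Rmax_lub_lt; assumption).
  assert (Hall : forall t, 0 <= t <= 1 -> exists w1 w2, w1 <> w2 /\ Cmod w1 <= rho /\
    Cmod w2 <= rho /\ F w1 = (t * v)%C /\ F w2 = (t * v)%C).
  { apply backward_induction.
    - exists z1, z2. split; [exact Hne |].
      split; [apply Rmax_l |]. split; [apply Rmax_r |].
      split; [unfold v; ring | unfold v; rewrite EF; ring].
    - intros m Hm Happ.
      destruct (disk_cluster_point (fun e w1 => exists w2 s, w1 <> w2 /\ Cmod w2 <= rho /\
        m <= s < m + e /\ F w1 = (s * v)%C /\ F w2 = (s * v)%C) rho) as [l1 [Hl1 Hc1]].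
      { intros e e' w1 Hee [w2 [s [H1 [H2 [H3 H4]]]]]. exists w2, s.
        repeat split; tauto || lra. }
      { intros e He. destruct (Happ e He) as [s [Hs [_ [w1 [w2 H]]]]].
        exists w1. split; [tauto |]. exists w2, s. tauto. }
      (* The second family records a partner [w1] close to [l1] with the same parameter [s], so that
         both limits arise from common pairs. *)
      destruct (disk_cluster_point (fun e w2 => exists w1 s, w1 <> w2 /\ Cmod (w1 - l1) < e /\
        m <= s < m + e /\ F w1 = (s * v)%C /\ F w2 = (s * v)%C) rho) as [l2 [Hl2 Hc2]].
      { intros e e' w2 Hee [w1 [s [H1 [H2 [H3 H4]]]]]. exists w1, s.
        repeat split; tauto || lra. }
      { intros e He. destruct (Hc1 e He) as [w1 [_ [H1 [w2 [s [H2 [H3 H4]]]]]]].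
        exists w2. split; [exact H3 |]. exists w1, s. tauto. }
      exists l1, l2. repeat split; try assumption.
      + intros <-. destruct (F_locally_injective l1 ltac:(lra)) as [d [Hd Hinj]].
        destruct (Hc2 d Hd) as [w2 [_ [H1 [w1 [s [H2 [H3 [_ [E1 E2]]]]]]]]].
        apply H2, Hinj; [exact H3 | exact H1 | congruence].
      + apply F_limit_value; [lra |]. intros e He.
        destruct (Hc2 e He) as [w2 [_ [H1 [w1 [s H]]]]]. exists w1, s. tauto.
      + apply F_limit_value; [lra |]. intros e He.
        destruct (Hc2 e He) as [w2 [_ [H1 [w1 [s H]]]]]. exists w2, s. tauto.
    - intros m Hm [w1 [w2 [Hw [Hw1 [Hw2 [E1 E2]]]]]].
      assert (Hmv : (m * v)%C <> 0%C) by (apply Cmult_neq_0; [apply RtoC_neq; lra | exact Hv]).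
      assert (H01 : w1 <> 0%C) by (intros ->; rewrite F_0 in E1; congruence).
      assert (H02 : w2 <> 0%C) by (intros ->; rewrite F_0 in E2; congruence).
      pose proof (Cmod_sub_gt_0 w1 w2 Hw) as Hsep.
      (* Moving each point by less than half of their distance keeps the two apart. *)
      destruct (shrink_preimage w1 ltac:(lra) H01 (Cmod (w1 - w2) / 2)) as [d1 [Hd1 S1]];
        [lra |].
      destruct (shrink_preimage w2 ltac:(lra) H02 (Cmod (w1 - w2) / 2)) as [d2 [Hd2 S2]];
        [lra |].
      pose proof (Rmin_l d1 d2). pose proof (Rmin_r d1 d2).
      exists (m * Rmin d1 d2).
      split; [apply Rmult_lt_0_compat; [lra | apply Rmin_pos; assumption] |]. intros s _ Hs.
      assert (Hq : 1 - Rmin d1 d2 < s / m < 1).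
      { split; apply Rmult_lt_reg_r with m; try lra; unfold Rdiv;
          rewrite Rmult_assoc, Rinv_l by lra; lra. }
      destruct (S1 (s / m) ltac:(lra)) as [u1 [A1 [B1 C1]]].
      destruct (S2 (s / m) ltac:(lra)) as [u2 [A2 [B2 C2]]].
      assert (Es : (RtoC (s / m) * (m * v))%C = (s * v)%C).
      { replace (RtoC s) with (RtoC (s / m) * RtoC m)%C; [ring |].
        rewrite <- RtoC_mult. f_equal. field. lra. }
      exists u1, u2. repeat split; try lra.
      + intros ->. pose proof (Cmod_triangle_sub w1 u2 w2) as H1.
        rewrite (Cmod_sub_sym w1 u2) in H1. lra.
      + rewrite C1, E1. exact Es.
      + rewrite C2, E2. exact Es. }
  destruct (Hall 0) as [w1 [w2 [Hw [Hw1 [Hw2 [E1 E2]]]]]]; [lra |].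
  rewrite Cmult_0_l in E1, E2. apply Hw.
  transitivity (RtoC 0); [| symmetry]; apply NNPP; intros H.
  - apply (F_nonvanishing w1); [lra | exact H | exact E1].
  - apply (F_nonvanishing w2); [lra | exact H | exact E2].
Qed.

Lemma starlike_of_Re_pos : starlike_wrt_0 F.
Proof.
  split; [exact F_injective |].
  intros t Ht w [z [Hz <-]].
  destruct (preimage_of_shrunk_value z t Hz Ht) as [u [Hu E]].
  exists u. split; [unfold unit_disk in *; lra | exact E].
Qed.

End RePos.

Lemma starlike_quotient_factor (z : C) : dF z = C_derive F z -> nonvanishing -> Cmod z < 1 ->
  starlike_quotient F z = p z.
Proof.
  intros Hd HF Hz. unfold starlike_quotient. destruct (Ceq_dec z 0) as [-> | Hz0].
  - symmetry. exact p_0.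
  - rewrite <- Hd. unfold p. rewrite (F_factor z). field.
    split; [apply F1_neq_0; assumption | exact Hz0].
Qed.

End Starlike.

Open Scope C_scope.

Theorem corollary3p8 (F : C -> C)
  (F_holo : holomorphic_on unit_disk F)
  (F_0 : F 0 = 0)
  (F'_0 : C_derive F 0 = 1) :
  (starlike_wrt_0 F <-> starlike_quotient_Re_pos F) /\
  (starlike_quotient_Re_pos F <-> radially_increasing_modulus F).
Proof.
  assert (F_deriv : forall z, (Cmod z < 1)%R -> cderiv F z (C_derive F z)).
  { intros z Hz. apply ex_derive_cderiv, F_holo, Hz. }
  (* The prescribed value 1 of the quotient at 0 is absorbed by the slope, so that the three
     conditions meet in one expression. *)
  assert (Hquot : starlike_quotient_Re_pos F <-> nonvanishing F /\
    forall z, (Cmod z < 1)%R -> (0 < Re (C_derive F z * / slope F 0 1 z))%R).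
  { split; intros [HF Hp]; (split; [exact HF |]); intros z Hz; specialize (Hp z Hz).
    - rewrite (starlike_quotient_factor F (C_derive F)) in Hp; auto.
    - rewrite (starlike_quotient_factor F (C_derive F)); auto. }
  rewrite Hquot. split; split.
  - apply Re_pos_of_starlike; assumption.
  - intros [HF Hp]. apply (starlike_of_Re_pos F (C_derive F)); assumption.
  - intros [HF Hp]. apply (radially_increasing_of_Re_pos F (C_derive F)); assumption.
  - apply Re_pos_of_radially_increasing; assumption.
Qed.
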